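(* Let $G$ be a finite group with homomorphisms $s,h:G\to\mathbb Z_2$, $\omega$ a normalized $U(1)$-valued 2-cocycle on $G$ (coefficients twisted by $s$), $A=\mathbb C[G,\omega,s]$ with $\mathbb Z_2$-grading $h$, and $V$ an orthogonal real representation of $G$ of dimension $q$. Let $\Psi:A^V\cong Cl^{0,q}\hat\otimes\mathbb C[G,\omega',s]$ be the separation-of-variables isomorphism and let $\Phi:\mathbb C[G,\omega',s]\cong\prod_iM_{d_i'}(D_i)(\bar c_i)$ be a $\mathbb Z_2$-graded Wedderburn--Artin decomposition. The components $i$ are in one-to-one correspondence with the components of the $\mathbb Z_2$-graded Wedderburn--Artin decomposition of $A^V$ and give a direct sum decomposition of $\mathcal A(A^V)$ into one summand for each $i$. Suppose the summand of $\mathcal A(A^V)$ for the index $i$ is $\mathbb Z_2$. Let $1_i$ be the identity element of $M_{d_i'}(D_i)(\bar c_i)$, let $a_i=\Psi^{-1}(1\hat\otimes\Phi^{-1}(1_i))\in A^V$, and let $n_i$ be the real dimension of the graded simple $A^V$-module belonging to component $i$. Then for every finite-dimensional $\mathbb Z_2$-graded $A^V$-module $N$ with representation $\rho_N$, the component of the class $[N]\in\mathcal A(A^V)$ in this $\mathbb Z_2$ summand equals $$\frac1{n_i}\,\mathrm{Tr}_{\mathbb R}\big(\rho_N(a_i)\big)\pmod 2 .$$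
   Context: Symmetry algebra. $G$ acts on $U(1)$ by ${}^g a=a$ if $s(g)=0$ and ${}^g a=\bar a$ if $s(g)=1$; $\omega$ is a 2-cocycle for this action with $\omega(1,g)=\omega(g,1)=1$. $\mathbb C[G,\omega,s]$ is the real associative algebra that is a left $\mathbb C$-vector space with basis $G$, with $g\cdot g'=\omega(g,g')\,gg'$ and $g z={}^g z\, g$ for $z\in\mathbb C$. A homomorphism $G\to\mathbb Z_2$ gives it a $\mathbb Z_2$-grading with $\mathbb C$ in degree 0. Algebra $A^V$. With $\tilde e_1,\dots,\tilde e_q$ an orthonormal basis of $V$ and $\rho_V:G\to O(V)$ the representation, $A^V$ is the real algebra generated by $A$ and $\tilde e_1,\dots,\tilde e_q$ with $\tilde e_i^2=1$, $\tilde e_i\tilde e_j=-\tilde e_j\tilde e_i$ ($i\neq j$), $\tilde e_iz=z\tilde e_i$ for $z\in\mathbb C\subset A$, and $(-1)^{h(g)}g\,\tilde e_i\,(g)^{-1}=\rho_V(g)(\tilde e_i)$. The $\tilde e_i$ have degree 1. Separation of variables. $Cl^{0,q}$ is the real Clifford algebra on $\tilde e_1,\dots,\tilde e_q$ (anticommuting, squaring to $1$, degree 1); $\hat\otimes$ is the super tensor product over $\mathbb R$ (degree-1 elements of the two factors anticommute). Let $\mathrm{Pin}\subset (Cl^{0,q})^\times$ be the group generated by unit vectors of $V$, a double cover of $O(V)$ via $x\mapsto(-1)^{\deg x}x(-)x^{-1}$ with kernel $\{\pm1\}$. For each $g$ choose a lift $\tilde\rho(g)\in\mathrm{Pin}$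 of $\rho_V(g)$ (with $\tilde\rho(1)=1$), let $\omega_Q(g_1,g_2)\in\mathbb Z_2$ be defined by $\tilde\rho(g_1)\tilde\rho(g_2)=(-1)^{\omega_Q(g_1,g_2)}\tilde\rho(g_1g_2)$, and let $o(g)\in\mathbb Z_2$ be defined by $\det\rho_V(g)=(-1)^{o(g)}$. Put $\omega'(g_1,g_2)=\omega(g_1,g_2)\,(-1)^{\omega_Q(g_1,g_2)+(h+o)(g_1)\,o(g_2)}$, and grade $\mathbb C[G,\omega',s]$ by $h+o$. $\Psi$ is the graded algebra isomorphism with $\tilde e_i\mapsto\tilde e_i\hat\otimes1$, $g\mapsto\tilde\rho(g)\hat\otimes g$, $z\mapsto 1\hat\otimes z$ for $z\in\mathbb C$. Graded Wedderburn--Artin decomposition. $D_i$ is a $\mathbb Z_2$-graded division algebra (all nonzero homogeneous elements invertible) and $M_d(D)(\bar c)$, $\bar c\in\mathbb Z_2^d$, is the matrix algebra graded so that degree $\lambda$ matrices have $(k,j)$ entry in $D_{c_k+\lambda-c_j}$. Algebraic classification. For a $\mathbb Z_2$-graded semisimple algebra $B$, $\mathcal N(B)$ is the free abelian group on isomorphism classes of irreducible $\mathbb Z_2$-graded $B$-modules. $\mathcal A(B)$ is the cokernel of the restriction map $\mathcal N(Cl^{0,1}\hat\otimes B)\to\mathcal N(B)$ induced by $B\hookrightarrow Cl^{0,1}\hat\otimes B$. It is compatible with products: $\mathcal A(\prod_iB_i)\cong\bigoplus_i\mathcal A(B_i)$. $\mathrm{Tr}_{\mathbb R}$ is the trace of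 a real-linear map. *)

(* Defs.v *)
From HB Require Import structures.
From mathcomp Require Import all_boot all_order all_fingroup all_algebra.
From mathcomp Require Import generic_quotient ring_quotient falgebra.
From mathcomp Require Import boolp classical_sets reals complex.
From mathcomp.multinomials Require Import freeg.

Set Implicit Arguments.
Unset Strict Implicit.
Unset Printing Implicit Defensive.

Import Order.TTheory GRing.Theory Num.Theory.
Local Open Scope ring_scope.
Local Open Scope quotient_scope.

(* Z_2 is bool with addb. A grading is given by the projections [hpart d] onto
   the homogeneous components; x is homogeneous of degree d iff
   hpart d x = x. *)
HB.mixin Record isSuper (R : fieldType) A of Falgebra R A := {
  hpart : bool -> A -> A;
  hpart_linear : forall d, linear (hpart d);
  hpart_sum : forall x, hpart false x + hpart true x = x;
  hpartK : forall d d' x, hpart d (hpart d' x) = if d == d' then hpart d x else 0;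
  hpart_1 : hpart false 1 = 1;
  hpartM : forall d d' x y,
    hpart (d (+) d') (hpart d x * hpart d' y) = hpart d x * hpart d' y
}.

#[short(type="superAlgType")]
HB.structure Definition SuperAlg (R : fieldType) :=
  { A of isSuper R A & Falgebra R A }.

Section HpartTheory.
Variables (R : fieldType) (A : superAlgType R).

HB.instance Definition _ d :=
  GRing.isLinear.Build R A A _ (@hpart R A d) (@hpart_linear R A d).

Definition homog (d : bool) (x : A) : Prop := hpart d x = x.

Lemma homog_hpart d x : homog d (hpart d x).
Proof. by rewrite /homog hpartK eqxx. Qed.

Lemma homog_hpartN d d' x : homog d x -> d' != d -> hpart d' x = 0.
Proof. by move=> <- /negPf e; rewrite hpartK e. Qed.

Lemma homog1 : homog false (1 : A).
Proof. exact: hpart_1. Qed.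

Lemma homogM d d' (x y : A) : homog d x -> homog d' y -> homog (d (+) d') (x * y).
Proof. by move=> <- <-; apply: hpartM. Qed.

End HpartTheory.

Record gahom (R : fieldType) (A B : superAlgType R) := GAHom {
  gah :> {lrmorphism A -> B};
  gah_hpart : forall d x, gah (hpart d x) = hpart d (gah x)
}.

(* Twisted algebras: K-linear combinations of the elements of a finite monoid,
   with  (z g) (w g') = z (^g w) c(g, g') (g g'). *)
Record twist (R : fieldType) (K : falgType R) (X : finType) := Twist {
  tmul : X -> X -> X;
  tone : X;
  tact : X -> K -> K;
  tcoc : X -> X -> K;
  tdeg : X -> bool;
  tmulA : associative tmul;
  tmul1l : left_id tone tmul;
  tmul1r : right_id tone tmul;
  tact_linear : forall g, linear (tact g);
  tactM : forall g, {morph tact g : z w / z * w};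
  tact1 : forall g, tact g 1 = 1;
  tact_1 : forall z, tact tone z = z;
  tact_mul : forall g g' z, tact (tmul g g') z = tact g (tact g' z);
  tcoc_central : forall g g' z, tcoc g g' * z = z * tcoc g g';
  tcoc_1l : forall g, tcoc tone g = 1;
  tcoc_1r : forall g, tcoc g tone = 1;
  tcocP : forall g g' g'',
    tact g (tcoc g' g'') * tcoc g (tmul g' g'') =
    tcoc g g' * tcoc (tmul g g') g'';
  tdegM : forall g g', tdeg (tmul g g') = tdeg g (+) tdeg g'
}.

Definition twalg (R : fieldType) (K : falgType R) (X : finType)
  (t : twist K X) : Type := {ffun X -> K}.

Section Twalg.
Variables (R : fieldType) (K : falgType R) (X : finType) (t : twist K X).
Local Notation twalg := (twalg t).

HB.instance Definition _ := Vector.on twalg.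

HB.instance Definition _ g :=
  GRing.isLinear.Build R K K _ (tact t g) (tact_linear t g).

(* z g *)
Definition twdelta (g : X) (z : K) : twalg := [ffun g' => if g' == g then z else 0].

Definition twmul (x y : twalg) : twalg :=
  \sum_g \sum_g' twdelta (tmul t g g') (x g * tact t g (y g') * tcoc t g g').

Definition twone : twalg := twdelta (tone t) 1.

Fact twdelta_linear g : linear (twdelta g).
Proof.
move=> a z w; apply/ffunP => g'; rewrite !ffunE; case: ifP => //.
by rewrite scaler0 addr0.
Qed.
HB.instance Definition _ g :=
  GRing.isLinear.Build R K twalg _ (twdelta g) (twdelta_linear g).

Lemma twE (x : twalg) : x = \sum_g twdelta g (x g).
Proof.
apply/ffunP => g; rewrite sum_ffunE (bigD1 g) //= ffunE eqxx big1 ?addr0 // => g' ne.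
by rewrite ffunE eq_sym (negPf ne).
Qed.

Lemma tw_ind (P : twalg -> Prop) :
  P 0 -> (forall x y, P x -> P y -> P (x + y)) -> (forall g z, P (twdelta g z)) ->
  forall x, P x.
Proof. by move=> P0 PD Pd x; rewrite (twE x); apply: big_ind. Qed.

Lemma twmulDl x y z : twmul (x + y) z = twmul x z + twmul y z.
Proof.
rewrite /twmul -big_split; apply: eq_bigr => g _ /=; rewrite -big_split /=.
by apply: eq_bigr => g' _; rewrite ffunE !mulrDl linearD.
Qed.

Lemma twmulDr x y z : twmul z (x + y) = twmul z x + twmul z y.
Proof.
rewrite /twmul -big_split; apply: eq_bigr => g _ /=; rewrite -big_split /=.
by apply: eq_bigr => g' _; rewrite ffunE linearD mulrDr mulrDl linearD.
Qed.

Lemma twmulZl (a : R) x y : twmul (a *: x) y = a *: twmul x y.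
Proof.
rewrite /twmul scaler_sumr; apply: eq_bigr => g _; rewrite scaler_sumr.
by apply: eq_bigr => g' _; rewrite ffunE -!scalerAl linearZ.
Qed.

Lemma twmulZr (a : R) x y : twmul x (a *: y) = a *: twmul x y.
Proof.
rewrite /twmul scaler_sumr; apply: eq_bigr => g _; rewrite scaler_sumr.
by apply: eq_bigr => g' _; rewrite ffunE linearZ /= -scalerAr -scalerAl linearZ.
Qed.

Lemma twmul0l x : twmul 0 x = 0.
Proof. by have := twmulZl 0 0 x; rewrite !scale0r. Qed.

Lemma twmul0r x : twmul x 0 = 0.
Proof. by have := twmulZr 0 x 0; rewrite !scale0r. Qed.

Lemma twmulE g z g' w :
  twmul (twdelta g z) (twdelta g' w) =
  twdelta (tmul t g g') (z * tact t g w * tcoc t g g').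
Proof.
rewrite /twmul (bigD1 g) //= (bigD1 g') //= !ffunE !eqxx.
rewrite big1 ?addr0 ?big1 ?addr0 // => [h ne|h ne].
  by apply: big1 => k _; rewrite ffunE (negPf ne) !mul0r linear0.
by rewrite ffunE (negPf ne) linear0 mulr0 mul0r linear0.
Qed.

Lemma twmulA : associative twmul.
Proof.
elim/tw_ind=> [|x x' Hx Hx'|g z] y v; first by rewrite !twmul0l.
  by rewrite !twmulDl Hx Hx'.
elim/tw_ind: y v => [|y y' Hy Hy'|g' z'] v; first by rewrite !(twmul0l, twmul0r).
  by rewrite !(twmulDl, twmulDr) Hy Hy'.
elim/tw_ind: v => [|v v' Hv Hv'|g'' z'']; first by rewrite !twmul0r.
  by rewrite !twmulDr Hv Hv'.
rewrite !twmulE tmulA; congr twdelta.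
rewrite !tactM tact_mul -!mulrA; congr (_ * (_ * _)).
by rewrite tcocP !mulrA tcoc_central.
Qed.

Lemma twmul1l : left_id twone twmul.
Proof.
elim/tw_ind=> [|x x' Hx Hx'|g z]; first by rewrite twmul0r.
  by rewrite twmulDr Hx Hx'.
by rewrite twmulE tmul1l tact_1 tcoc_1l mul1r mulr1.
Qed.

Lemma twmul1r : right_id twone twmul.
Proof.
elim/tw_ind=> [|x x' Hx Hx'|g z]; first by rewrite twmul0l.
  by rewrite twmulDl Hx Hx'.
by rewrite twmulE tmul1r tact1 tcoc_1r !mulr1.
Qed.

Lemma twone_neq0 : twone != 0.
Proof.
by apply/eqP => /ffunP/(_ (tone t)); rewrite !ffunE eqxx; apply/eqP/oner_neq0.
Qed.

HB.instance Definition _ := GRing.Zmodule_isNzRing.Build twalg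
  twmulA twmul1l twmul1r (fun x y z => twmulDl x y z) (fun x y z => twmulDr y z x)
  twone_neq0.
HB.instance Definition _ := GRing.Lmodule_isLalgebra.Build R twalg
  (fun a x y => esym (twmulZl a x y)).
HB.instance Definition _ := GRing.Lalgebra_isAlgebra.Build R twalg
  (fun a x y => esym (twmulZr a x y)).
HB.instance Definition _ := Algebra_isFalgebra.Build R twalg.

Lemma twdeltaM g z g' w :
  twdelta g z * twdelta g' w =
  twdelta (tmul t g g') (z * tact t g w * tcoc t g g').
Proof. exact: twmulE. Qed.

Definition twpart (d : bool) (x : twalg) : twalg :=
  [ffun g => if tdeg t g == d then x g else 0].

Fact twpart_linear d : linear (twpart d).
Proof.
move=> a x y; apply/ffunP => g; rewrite !ffunE; case: ifP => //.
by rewrite scaler0 addr0.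
Qed.
HB.instance Definition _ d :=
  GRing.isLinear.Build R twalg twalg _ (twpart d) (twpart_linear d).

Fact twpart_sum x : twpart false x + twpart true x = x.
Proof. by apply/ffunP => g; rewrite !ffunE; case: (tdeg t g); rewrite (addr0, add0r). Qed.

Fact twpartK d d' x : twpart d (twpart d' x) = if d == d' then twpart d x else 0.
Proof.
apply/ffunP => g; rewrite !ffunE.
by case: d d' => -[]; rewrite !ffunE; case: (tdeg t g).
Qed.

Lemma twpart_delta d g z : twpart d (twdelta g z) = if tdeg t g == d then twdelta g z else 0.
Proof.
apply/ffunP => g'; case: ifP => e; rewrite !ffunE; last by case: (eqVneq g' g) => [->|]; rewrite ?e ?if_same.
by case: (eqVneq g' g) => [->|]; rewrite ?e ?if_same.
Qed.

Lemma tdeg1 : tdeg t (tone t) = false.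
Proof. by have := tdegM t (tone t) (tone t); rewrite tmul1l; case: (tdeg _ _). Qed.

Fact twpart_1 : twpart false 1 = 1.
Proof. by rewrite twpart_delta tdeg1. Qed.

Fact twpartM d d' (x y : twalg) :
  twpart (d (+) d') (twpart d x * twpart d' y) = twpart d x * twpart d' y.
Proof.
elim/tw_ind: x => [|x x' Hx Hx'|g z]; first by rewrite linear0 !mul0r linear0.
  by rewrite linearD /= mulrDl linearD /= Hx Hx'.
elim/tw_ind: y => [|y y' Hy Hy'|g' z']; first by rewrite linear0 !mulr0 linear0.
  by rewrite linearD /= mulrDr linearD /= Hy Hy'.
rewrite !twpart_delta; case: eqP => [<-|_]; last by rewrite mul0r linear0.
case: eqP => [<-|_]; last by rewrite mulr0 linear0.
by rewrite twdeltaM twpart_delta tdegM eqxx.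
Qed.

HB.instance Definition _ := isSuper.Build R twalg
  twpart_linear twpart_sum twpartK twpart_1 twpartM.

End Twalg.

(* The super tensor product over R. An element is given by its coordinates in
   B along a fixed basis of A, so that stens A B is the real tensor product with
   a (x) b = [tens a b]; the product is
   (a (x) b) (a' (x) b') = (-1)^(|b||a'|) a a' (x) b b'  (see tensM). *)
Section Stens.
Variables (R : fieldType) (A B : superAlgType R).

Definition stens : Type := {ffun 'I_(\dim {:A}) -> B}.
HB.instance Definition _ := Vector.on stens.

Local Notation bas i := ((vbasis {:A})`_i).

Definition tens (a : A) (b : B) : stens := [ffun i => coord (vbasis {:A}) i a *: b].

(* (a (x) b) (a' (x) b') for not necessarily homogeneous b and a' *)
Definition tens4 (a : A) (b : B) (a' : A) (b' : B) : stens :=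
  \sum_(d : bool) \sum_(d' : bool)
    (-1) ^+ (d && d') *: tens (a * hpart d' a') (hpart d b * b').

Definition stmul (x y : stens) : stens :=
  \sum_(i < \dim {:A}) \sum_(j < \dim {:A}) tens4 (bas i) (x i) (bas j) (y j).

Definition stone : stens := tens 1 1.

Lemma tensDl a a' b : tens (a + a') b = tens a b + tens a' b.
Proof. by apply/ffunP => i; rewrite !ffunE linearD scalerDl. Qed.

Lemma tensDr a b b' : tens a (b + b') = tens a b + tens a b'.
Proof. by apply/ffunP => i; rewrite !ffunE scalerDr. Qed.

Lemma tensZl (k : R) a b : tens (k *: a) b = k *: tens a b.
Proof. by apply/ffunP => i; rewrite !ffunE linearZ scalerA. Qed.

Lemma tensZr (k : R) a b : tens a (k *: b) = k *: tens a b.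
Proof. by apply/ffunP => i; rewrite !ffunE !scalerA mulrC. Qed.

Lemma tens0l b : tens 0 b = 0.
Proof. by rewrite -(scale0r (0 : A)) tensZl scale0r. Qed.

Lemma tens0r a : tens a 0 = 0.
Proof. by rewrite -(scale0r (0 : B)) tensZr scale0r. Qed.

Lemma tens_suml I (r : seq I) (F : I -> A) b :
  tens (\sum_(i <- r) F i) b = \sum_(i <- r) tens (F i) b.
Proof. by apply: (big_morph (tens^~ b)) => [x y|]; rewrite (tensDl, tens0l). Qed.

Lemma tens_sumr I (r : seq I) (F : I -> B) a :
  tens a (\sum_(i <- r) F i) = \sum_(i <- r) tens a (F i).
Proof. by apply: (big_morph (tens a)) => [x y|]; rewrite (tensDr, tens0r). Qed.

Lemma tens_coord (x : stens) : x = \sum_(i < \dim {:A}) tens (bas i) (x i).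
Proof.
apply/ffunP => j; rewrite sum_ffunE (bigD1 j) //= big1 => [|i ne].
  by rewrite addr0 ffunE coord_free ?(basis_free (vbasisP _)) // eqxx scale1r.
rewrite ffunE coord_free ?(basis_free (vbasisP _)) //.
by rewrite (negPf ne) scale0r.
Qed.

Lemma stens_ind (P : stens -> Prop) :
    P 0 -> (forall x y, P x -> P y -> P (x + y)) ->
    (forall d d' a b, homog d a -> homog d' b -> P (tens a b)) ->
  forall x, P x.
Proof.
move=> P0 PD Pt x; rewrite (tens_coord x); apply: big_ind => // i _.
rewrite -[bas i]hpart_sum -[x i]hpart_sum tensDl !tensDr.
by apply: (PD); apply: (PD); apply: (Pt); apply: homog_hpart.
Qed.

Lemma tens4E d d' a b a' b' : homog d b -> homog d' a' ->
  tens4 a b a' b' = (-1) ^+ (d && d') *: tens (a * a') (b * b').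
Proof.
move=> hb ha'; rewrite /tens4 (bigD1 d) //= (bigD1 d') //= hb ha'.
rewrite !big1 ?addr0 // => e ne.
  by rewrite big1 // => e' _; rewrite (homog_hpartN hb ne) mul0r tens0r scaler0.
by rewrite (homog_hpartN ha' ne) mulr0 tens0l scaler0.
Qed.

Definition t4_1 b a' b' a := tens4 a b a' b'.
Fact tens4_linear1 b a' b' : linear (t4_1 b a' b').
Proof.
move=> k x y; rewrite /t4_1 /tens4 scaler_sumr -big_split; apply: eq_bigr => d _ /=.
rewrite scaler_sumr -big_split; apply: eq_bigr => d' _ /=.
by rewrite mulrDl -scalerAl tensDl tensZl scalerDr !scalerA mulrC.
Qed.
HB.instance Definition _ b a' b' :=
  GRing.isLinear.Build R A stens _ (t4_1 b a' b') (tens4_linear1 b a' b').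

Lemma tens4_sum1 I (r : seq I) (F : I -> A) b a' b' : tens4 (\sum_(i <- r) F i) b a' b' = \sum_(i <- r) tens4 (F i) b a' b'.
Proof. exact: (linear_sum (t4_1 b a' b')). Qed.

Lemma tens4Z1 k a b a' b' : tens4 (k *: a) b a' b' = k *: tens4 a b a' b'.
Proof. exact: (linearZ_LR (t4_1 b a' b')). Qed.

Definition t4_2 a a' b' b := tens4 a b a' b'.
Fact tens4_linear2 a a' b' : linear (t4_2 a a' b').
Proof.
move=> k x y; rewrite /t4_2 /tens4 scaler_sumr -big_split; apply: eq_bigr => d _ /=.
rewrite scaler_sumr -big_split; apply: eq_bigr => d' _ /=.
by rewrite linearP mulrDl -scalerAl tensDr tensZr scalerDr !scalerA mulrC.
Qed.
HB.instance Definition _ a a' b' :=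
  GRing.isLinear.Build R B stens _ (t4_2 a a' b') (tens4_linear2 a a' b').

Lemma tens4_sum2 I (r : seq I) (F : I -> B) a a' b' : tens4 a (\sum_(i <- r) F i) a' b' = \sum_(i <- r) tens4 a (F i) a' b'.
Proof. exact: (linear_sum (t4_2 a a' b')). Qed.

Lemma tens4Z2 k a b a' b' : tens4 a (k *: b) a' b' = k *: tens4 a b a' b'.
Proof. exact: (linearZ_LR (t4_2 a a' b')). Qed.

Definition t4_3 a b b' a' := tens4 a b a' b'.
Fact tens4_linear3 a b b' : linear (t4_3 a b b').
Proof.
move=> k x y; rewrite /t4_3 /tens4 scaler_sumr -big_split; apply: eq_bigr => d _ /=.
rewrite scaler_sumr -big_split; apply: eq_bigr => d' _ /=.
by rewrite linearP mulrDr -scalerAr tensDl tensZl scalerDr !scalerA mulrC.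
Qed.
HB.instance Definition _ a b b' :=
  GRing.isLinear.Build R A stens _ (t4_3 a b b') (tens4_linear3 a b b').

Lemma tens4_sum3 I (r : seq I) (F : I -> A) a b b' : tens4 a b (\sum_(i <- r) F i) b' = \sum_(i <- r) tens4 a b (F i) b'.
Proof. exact: (linear_sum (t4_3 a b b')). Qed.

Lemma tens4Z3 k a b a' b' : tens4 a b (k *: a') b' = k *: tens4 a b a' b'.
Proof. exact: (linearZ_LR (t4_3 a b b')). Qed.

Fact tens4_linear4 a b a' : linear (tens4 a b a').
Proof.
move=> k x y; rewrite /tens4 scaler_sumr -big_split; apply: eq_bigr => d _ /=.
rewrite scaler_sumr -big_split; apply: eq_bigr => d' _ /=.
by rewrite mulrDr -scalerAr tensDr tensZr scalerDr !scalerA mulrC.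
Qed.
HB.instance Definition _ a b a' :=
  GRing.isLinear.Build R B stens _ (tens4 a b a') (tens4_linear4 a b a').

Lemma stmulDl x y z : stmul (x + y) z = stmul x z + stmul y z.
Proof.
rewrite /stmul -big_split; apply: eq_bigr => i _ /=; rewrite -big_split /=.
apply: eq_bigr => j _; rewrite ffunE.
exact: (linearD (t4_2 (bas i) (bas j) (z j))).
Qed.

Lemma stmulDr x y z : stmul z (x + y) = stmul z x + stmul z y.
Proof.
rewrite /stmul -big_split; apply: eq_bigr => i _ /=; rewrite -big_split /=.
by apply: eq_bigr => j _; rewrite ffunE linearD.
Qed.

Lemma stmulZl (k : R) x y : stmul (k *: x) y = k *: stmul x y.
Proof.
rewrite /stmul scaler_sumr; apply: eq_bigr => i _; rewrite scaler_sumr.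
apply: eq_bigr => j _; rewrite ffunE.
exact: tens4Z2.
Qed.

Lemma stmulZr (k : R) x y : stmul x (k *: y) = k *: stmul x y.
Proof.
rewrite /stmul scaler_sumr; apply: eq_bigr => i _; rewrite scaler_sumr.
by apply: eq_bigr => j _; rewrite ffunE linearZ.
Qed.

Lemma stmul0l x : stmul 0 x = 0.
Proof. by have := stmulZl 0 0 x; rewrite !scale0r. Qed.

Lemma stmul0r x : stmul x 0 = 0.
Proof. by have := stmulZr 0 x 0; rewrite !scale0r. Qed.

Lemma stmulE a b a' b' : stmul (tens a b) (tens a' b') = tens4 a b a' b'.
Proof.
rewrite [in RHS](coord_vbasis (memvf a)) [in RHS](coord_vbasis (memvf a')).
rewrite tens4_sum1; apply: eq_bigr => i _; rewrite tens4_sum3; apply: eq_bigr => j _.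
by rewrite !ffunE linearZ /= tens4Z1 tens4Z2 tens4Z3 !scalerA mulrC.
Qed.

Lemma stmul_homog d d' a b a' b' : homog d b -> homog d' a' ->
  stmul (tens a b) (tens a' b') = (-1) ^+ (d && d') *: tens (a * a') (b * b').
Proof. by rewrite stmulE; apply: tens4E. Qed.

Lemma stmulA : associative stmul.
Proof.
elim/stens_ind=> [|x x' Hx Hx'|d d' a b ha hb] y v; first by rewrite !stmul0l.
  by rewrite !stmulDl Hx Hx'.
elim/stens_ind: y v => [|y y' Hy Hy'|e e' a' b' ha' hb'] v.
- by rewrite !(stmul0l, stmul0r).
- by rewrite !(stmulDl, stmulDr) Hy Hy'.
elim/stens_ind: v => [|v v' Hv Hv'|f f' a2 b2 ha2 hb2]; first by rewrite !stmul0r.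
  by rewrite !stmulDr Hv Hv'.
rewrite (stmul_homog _ _ hb' ha2) (stmul_homog _ _ hb ha') stmulZl stmulZr.
rewrite (stmul_homog _ _ (homogM hb hb') ha2) (stmul_homog _ _ hb (homogM ha' ha2)).
rewrite !scalerA !mulrA -!signr_addb; congr (_ ^+ (nat_of_bool _) *: _).
by case: d' e e' f {hb ha' hb' ha2} => [] [] [] [].
Qed.

Lemma stmul1l : left_id stone stmul.
Proof.
elim/stens_ind=> [|x x' Hx Hx'|d d' a b ha hb]; first by rewrite stmul0r.
  by rewrite stmulDr Hx Hx'.
by rewrite (stmul_homog _ _ (homog1 _) ha) scale1r !mul1r.
Qed.

Lemma stmul1r : right_id stone stmul.
Proof.
elim/stens_ind=> [|x x' Hx Hx'|d d' a b ha hb]; first by rewrite stmul0l.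
  by rewrite stmulDl Hx Hx'.
by rewrite (stmul_homog _ _ hb (homog1 _)) andbF scale1r !mulr1.
Qed.

Lemma tens_eq0 a b : a != 0 -> tens a b = 0 -> b = 0.
Proof.
move=> a0 /ffunP tab; apply/eqP; apply: contraNT a0 => b0.
rewrite (coord_vbasis (memvf a)) big1 // => i _.
move: (tab i); rewrite !ffunE => /eqP; rewrite scaler_eq0 (negPf b0) orbF => /eqP ->.
by rewrite scale0r.
Qed.

Lemma stone_neq0 : stone != 0.
Proof. by apply/eqP => /(tens_eq0 (oner_neq0 A))/eqP; rewrite oner_eq0. Qed.

HB.instance Definition _ := GRing.Zmodule_isNzRing.Build stens
  stmulA stmul1l stmul1r (fun x y z => stmulDl x y z) (fun x y z => stmulDr y z x)
  stone_neq0.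
HB.instance Definition _ := GRing.Lmodule_isLalgebra.Build R stens
  (fun a x y => esym (stmulZl a x y)).
HB.instance Definition _ := GRing.Lalgebra_isAlgebra.Build R stens
  (fun a x y => esym (stmulZr a x y)).
HB.instance Definition _ := Algebra_isFalgebra.Build R stens.

Lemma tensM d d' a b a' b' : homog d b -> homog d' a' ->
  tens a b * tens a' b' = (-1) ^+ (d && d') *: tens (a * a') (b * b').
Proof. exact: stmul_homog. Qed.

(* degree d part: sum over e of A_e (x) B_(d + e) *)
Definition stpart (d : bool) (x : stens) : stens :=
  \sum_(i < \dim {:A}) \sum_(e : bool)
    tens (hpart e (bas i)) (hpart (d (+) e) (x i)).

Fact stpart_linear d : linear (stpart d).
Proof.
move=> k x y; rewrite /stpart scaler_sumr -big_split; apply: eq_bigr => i _ /=.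
rewrite scaler_sumr -big_split; apply: eq_bigr => e _ /=.
by rewrite !ffunE linearP tensDr tensZr.
Qed.
HB.instance Definition _ d :=
  GRing.isLinear.Build R stens stens _ (stpart d) (stpart_linear d).

Lemma stpart_tens d e e' a b : homog e a -> homog e' b ->
  stpart d (tens a b) = if d == e (+) e' then tens a b else 0.
Proof.
move=> ha hb.
have -> : stpart d (tens a b) = \sum_(f : bool) tens (hpart f a) (hpart (d (+) f) b).
  rewrite {2}(coord_vbasis (memvf a)) /stpart exchange_big; apply: eq_bigr => f _.
  rewrite linear_sum tens_suml; apply: eq_bigr => i _.
  by rewrite ffunE !linearZ tensZr tensZl.
rewrite (bigD1 e) //= big1 ?addr0 => [|f ne]; last by rewrite (homog_hpartN ha ne) tens0l.
rewrite ha; case: eqP => [->|/eqP ne]; first by rewrite addbAC addbb /= hb.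
rewrite (homog_hpartN hb) ?tens0r //; apply: contraNneq ne => <-.
by rewrite addbC -addbA addbb addbF.
Qed.

Fact stpart_sum x : stpart false x + stpart true x = x.
Proof.
elim/stens_ind: x => [|x y Hx Hy|d d' a b ha hb]; first by rewrite !linear0 addr0.
  by rewrite !linearD /= addrACA Hx Hy.
by rewrite !(stpart_tens _ ha hb); case: (d (+) d'); rewrite (addr0, add0r).
Qed.

Fact stpartK d d' x : stpart d (stpart d' x) = if d == d' then stpart d x else 0.
Proof.
elim/stens_ind: x => [|x y Hx Hy|e e' a b ha hb]; first by rewrite !linear0 if_same.
  by rewrite !linearD /= Hx Hy; case: ifP; rewrite ?addr0.
rewrite !(stpart_tens _ ha hb) (fun_if (stpart d)) linear0 (stpart_tens _ ha hb).
by case: d d' (e (+) e') => [] [] [].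
Qed.

Fact stpart_1 : stpart false 1 = 1.
Proof. by rewrite (stpart_tens _ (homog1 A) (homog1 B)). Qed.

Fact stpartM d d' (x y : stens) :
  stpart (d (+) d') (stpart d x * stpart d' y) = stpart d x * stpart d' y.
Proof.
elim/stens_ind: x => [|x x' Hx Hx'|e e' a b ha hb].
- by rewrite linear0 !mul0r linear0.
- by rewrite linearD /= mulrDl linearD /= Hx Hx'.
elim/stens_ind: y => [|y y' Hy Hy'|f f' a' b' ha' hb'].
- by rewrite linear0 !mulr0 linear0.
- by rewrite linearD /= mulrDr linearD /= Hy Hy'.
rewrite (stpart_tens _ ha hb) (stpart_tens _ ha' hb').
case: eqP => [->|_]; last by rewrite mul0r linear0.
case: eqP => [->|_]; last by rewrite mulr0 linear0.
rewrite (tensM _ _ hb ha') linearZ /= (stpart_tens _ (homogM ha ha') (homogM hb hb')).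
by rewrite addbACA eqxx.
Qed.

HB.instance Definition _ := isSuper.Build R stens
  stpart_linear stpart_sum stpartK stpart_1 stpartM.

Lemma hpart_tens d e e' a b : homog e a -> homog e' b ->
  hpart d (tens a b) = if d == e (+) e' then tens a b else 0.
Proof. exact: stpart_tens. Qed.

(* B -> A (x) B, b |-> 1 (x) b *)
Definition sinr (b : B) : stens := tens 1 b.

Fact sinr_linear : linear sinr.
Proof. by move=> k x y; rewrite /sinr tensDr tensZr. Qed.
HB.instance Definition _ := GRing.isLinear.Build R B stens _ sinr sinr_linear.

Lemma sinrM x y : sinr (x * y) = sinr x * sinr y.
Proof.
rewrite -[x]hpart_sum mulrDl !linearD mulrDl /=.
by congr (_ + _); rewrite /sinr (tensM _ _ (homog_hpart _ _) (homog1 _)) andbF scale1r mulr1.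
Qed.
HB.instance Definition _ := GRing.isMonoidMorphism.Build B stens sinr
  (conj (erefl : sinr 1 = 1) sinrM).

Lemma sinr_hpart d x : sinr (hpart d x) = hpart d (sinr x).
Proof.
rewrite -{2}[x]hpart_sum linearD linearD /= /sinr.
rewrite !(hpart_tens d (homog1 _) (homog_hpart _ _)).
by case: d; rewrite (addr0, add0r).
Qed.

Definition gsinr : gahom B stens := GAHom sinr_hpart.

End Stens.

Fact vect_transport (R : fieldType) (V : lmodType R) (W : vectType R) (f : V -> W) :
  linear f -> bijective f -> Vector.axiom (\dim {:W}) V.
Proof.
move=> f_lin f_bij; exists (fun v => \row_i coord (vbasis {:W}) i (f v)) => [k x y|].
  by apply/rowP => i; rewrite !mxE f_lin linearP.
pose g (r : 'rV[R]_(\dim {:W})) : W := \sum_i r 0 i *: (vbasis {:W})`_i.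
apply: (@bij_comp _ _ _ (fun w : W => \row_i coord (vbasis {:W}) i w)) f_bij.
exists g => [w|r]; rewrite /g.
  by rewrite [RHS](coord_vbasis (memvf w)); apply: eq_bigr => i _; rewrite mxE.
by apply/rowP => i; rewrite mxE coord_sum_free ?(basis_free (vbasisP _)).
Qed.

(* M_(n.+1)(D)(c): the degree d matrices have (k, j) entry of degree
   c k + d - c j. The size is n.+1 because the zero ring is not a component. *)
Definition gmx (R : fieldType) (D : superAlgType R) (n : nat)
  (c : 'I_n.+1 -> bool) : Type := 'M[D]_n.+1.

Section Gmx.
Variables (R : fieldType) (D : superAlgType R) (n : nat) (c : 'I_n.+1 -> bool).
Local Notation gmx := (gmx D c).

HB.instance Definition _ := GRing.NzRing.on gmx.

Definition gmscale (k : R) (x : gmx) : gmx := (\matrix_(i, j) (k *: (x i j : D)) : 'M_n.+1).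

Fact gmscaleA a b x : gmscale a (gmscale b x) = gmscale (a * b) x.
Proof. by apply/matrixP => i j; rewrite !mxE scalerA. Qed.
Fact gmscale1 : left_id 1 gmscale.
Proof. by move=> x; apply/matrixP => i j; rewrite !mxE scale1r. Qed.
Fact gmscaleDr : right_distributive gmscale +%R.
Proof. by move=> k x y; apply/matrixP => i j; rewrite !mxE scalerDr. Qed.
Fact gmscaleDl x : {morph gmscale^~ x : a b / a + b}.
Proof. by move=> a b; apply/matrixP => i j; rewrite !mxE scalerDl. Qed.
HB.instance Definition _ := GRing.Zmodule_isLmodule.Build R gmx
  gmscaleA gmscale1 gmscaleDr gmscaleDl.

Lemma gmxZE (k : R) (x : gmx) i j : (k *: x) i j = k *: x i j.
Proof. by rewrite mxE. Qed.

Fact gmscaleAl (k : R) (x y : gmx) : k *: (x * y) = (k *: x) * y.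
Proof.
apply/matrixP => i j; rewrite gmxZE !mxE scaler_sumr; apply: eq_bigr => l _.
by rewrite gmxZE scalerAl.
Qed.
Fact gmscaleAr (k : R) (x y : gmx) : k *: (x * y) = x * (k *: y).
Proof.
apply/matrixP => i j; rewrite gmxZE !mxE scaler_sumr; apply: eq_bigr => l _.
by rewrite gmxZE scalerAr.
Qed.
HB.instance Definition _ := GRing.Lmodule_isLalgebra.Build R gmx gmscaleAl.
HB.instance Definition _ := GRing.Lalgebra_isAlgebra.Build R gmx gmscaleAr.

Definition gmx_ffun (x : gmx) : {ffun 'I_n.+1 * 'I_n.+1 -> D} := [ffun p => x p.1 p.2].
Fact gmx_ffun_linear : linear gmx_ffun.
Proof. by move=> k x y; apply/ffunP => p; rewrite !ffunE mxE gmxZE. Qed.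
Fact gmx_ffun_bij : bijective gmx_ffun.
Proof.
exists (fun f : {ffun 'I_n.+1 * 'I_n.+1 -> D} => (\matrix_(i, j) f (i, j) : 'M_n.+1)) => [x|f].
  by apply/matrixP => i j; rewrite mxE ffunE.
by apply/ffunP => -[i j]; rewrite ffunE mxE.
Qed.
Definition gmx_vect_iso : Vector.axiom _ gmx :=
  vect_transport gmx_ffun_linear gmx_ffun_bij.
HB.instance Definition _ := Lmodule_hasFinDim.Build R gmx gmx_vect_iso.
HB.instance Definition _ := Algebra_isFalgebra.Build R gmx.

Definition gmpart (d : bool) (x : gmx) : gmx :=
  (\matrix_(k, j) hpart (c k (+) d (+) c j) (x k j : D) : 'M_n.+1).

Fact gmpart_linear d : linear (gmpart d).
Proof. by move=> k x y; apply/matrixP => i j; rewrite !mxE linearP. Qed.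

Fact gmpart_sum x : gmpart false x + gmpart true x = x.
Proof.
apply/matrixP => i j; rewrite !mxE.
by case: (c i) (c j) => [] [] /=; rewrite ?hpart_sum // addrC hpart_sum.
Qed.

Fact gmpartK d d' x : gmpart d (gmpart d' x) = if d == d' then gmpart d x else 0.
Proof.
apply/matrixP => i j; rewrite !mxE hpartK.
have -> : (c i (+) d (+) c j == c i (+) d' (+) c j) = (d == d').
  by case: (c i) (c j) d d' => [] [] [] [].
by case: (d == d'); rewrite mxE.
Qed.

Fact gmpart_1 : gmpart false 1 = 1.
Proof.
apply/matrixP => i j; rewrite !mxE addbF; case: eqP => [->|_].
  by rewrite addbb hpart_1.
by rewrite linear0.
Qed.

Fact gmpartM d d' (x y : gmx) :
  gmpart (d (+) d') (gmpart d x * gmpart d' y) = gmpart d x * gmpart d' y.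
Proof.
apply/matrixP => i j; rewrite !mxE linear_sum; apply: eq_bigr => k _.
rewrite !mxE.
have -> : c i (+) (d (+) d') (+) c j = (c i (+) d (+) c k) (+) (c k (+) d' (+) c j).
  by case: (c i) (c j) (c k) d d' => [] [] [] [] [].
exact: hpartM.
Qed.

HB.instance Definition _ := isSuper.Build R gmx
  gmpart_linear gmpart_sum gmpartK gmpart_1 gmpartM.

End Gmx.

Definition gdivision (R : fieldType) (D : superAlgType R) : Prop :=
  forall d (x : D), homog d x -> x != 0 -> x \is a GRing.unit.

(* A decomposition B = prod_i M_(n i).+1 (D i)(c i) with the D i graded division
   algebras; [Phi i] is the i-th component of the isomorphism. *)
Definition wedderburn (R : fieldType) (B : superAlgType R) (I : finType)
    (D : I -> superAlgType R) (n : I -> nat) (c : forall i, 'I_(n i).+1 -> bool)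
    (Phi : forall i, gahom B (gmx (D i) (c i))) : Prop :=
  (forall i, gdivision (D i)) /\
  (forall y : (forall i, gmx (D i) (c i)), exists! x : B, forall i, Phi i x = y i).

(* Cl^{0,q} on the basis e_S, S a subset of {0, .., q-1}, e_S being the increasing
   product of the generators: e_S e_T = (-1)^m e_(S xor T), where m is the number
   of pairs (i, j) in S x T with j < i. *)
Definition setsym (X : finType) (S T : {set X}) : {set X} := (S :\: T) :|: (T :\: S).

Lemma in_setsym (X : finType) (S T : {set X}) x :
  (x \in setsym S T) = (x \in S) (+) (x \in T).
Proof. by rewrite !inE; case: (x \in S) (x \in T) => [] []. Qed.

Lemma odd_setsym (X : finType) (S T : {set X}) :
  odd #|setsym S T| = odd #|S| (+) odd #|T|.
Proof.
rewrite /setsym cardsU (_ : _ :&: _ = finset.set0) ?cards0 ?subn0; last first.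
  by apply/finset.setP => x; rewrite !inE; case: (x \in S) (x \in T) => [] [].
rewrite -(cardsID T S) -(cardsID S T) !oddD (finset.setIC T S).
by case: (odd _) (odd _) (odd _) => [] [] [].
Qed.

Section Clifford.
Variables (R : fieldType) (q : nat).
Implicit Types (S T U : {set 'I_q}).

Definition inversions S T : {set 'I_q * 'I_q} :=
  [set p | [&& p.1 \in S, p.2 \in T & (p.2 < p.1)%N]].

Lemma inversionsDl S T U :
  odd #|inversions (setsym S T) U| = odd #|inversions S U| (+) odd #|inversions T U|.
Proof.
rewrite -odd_setsym; congr (odd #|pred_of_set _|); apply/finset.setP => p.
by rewrite in_setsym !inE; do 4?case: (_ \in _); case: (_ < _)%N.
Qed.

Lemma inversionsDr S T U :
  odd #|inversions U (setsym S T)| = odd #|inversions U S| (+) odd #|inversions U T|.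
Proof.
rewrite -odd_setsym; congr (odd #|pred_of_set _|); apply/finset.setP => p.
by rewrite in_setsym !inE; do 4?case: (_ \in _); case: (_ < _)%N.
Qed.

Lemma setsymA : associative (@setsym 'I_q).
Proof. by move=> S T U; apply/finset.setP => x; rewrite !in_setsym addbA. Qed.
Lemma setsym0l : left_id finset.set0 (@setsym 'I_q).
Proof. by move=> S; apply/finset.setP => x; rewrite in_setsym inE. Qed.
Lemma setsym0r : right_id finset.set0 (@setsym 'I_q).
Proof. by move=> S; apply/finset.setP => x; rewrite in_setsym inE addbF. Qed.

Lemma inversions0l S : inversions finset.set0 S = finset.set0.
Proof. by apply/finset.setP => p; rewrite !inE. Qed.
Lemma inversions0r S : inversions S finset.set0 = finset.set0.
Proof. by apply/finset.setP => p; rewrite !inE /= andbF. Qed.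

Program Definition cliff_twist : twist (R^o : falgType R) {set 'I_q} :=
  @Twist R R^o _ (@setsym 'I_q) finset.set0 (fun _ z => z)
    (fun S T => (-1) ^+ odd #|inversions S T|) (fun S => odd #|S|)
    setsymA setsym0l setsym0r _ _ _ _ _ _ _ _ _ _.
Next Obligation. by []. Qed.
Next Obligation. by []. Qed.
Next Obligation. by rewrite mulrC. Qed.
Next Obligation. by rewrite inversions0l cards0. Qed.
Next Obligation. by rewrite inversions0r cards0. Qed.
Next Obligation.
rewrite -!signr_addb inversionsDl inversionsDr; congr (_ ^+ nat_of_bool _).
by do 3!case: (odd _).
Qed.
Next Obligation. exact: odd_setsym. Qed.

Definition Cl : superAlgType R := twalg cliff_twist.

Definition clgen (i : 'I_q) : Cl := twdelta cliff_twist [set i] 1.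

(* V = R^q inside Cl^{0,q} *)
Definition clvec (v : 'cV[R]_q) : Cl := \sum_i v i 0 *: clgen i.

(* v ^ 2 = 1 for a unit vector, so the group generated by the unit vectors
   consists of their products. *)
Definition in_pin (x : Cl) : Prop :=
  exists2 vs : seq 'cV[R]_q,
    {in vs, forall v, v^T *m v = 1%:M} & x = \prod_(v <- vs) clvec v.

Lemma clgen_sqr i : clgen i * clgen i = 1.
Proof.
rewrite /clgen twdeltaM /= (_ : setsym _ _ = finset.set0); last first.
  by apply/finset.setP => x; rewrite in_setsym addbb inE.
rewrite (_ : inversions _ _ = finset.set0) ?cards0 ?mulr1 //.
apply/finset.setP => -[j k]; rewrite !inE /=.
by case: eqP => // ->; case: eqP => // ->; rewrite ltnn.
Qed.

Lemma clgen_anti i j : i != j -> clgen i * clgen j = - (clgen j * clgen i).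
Proof.
move=> ne; rewrite /clgen !twdeltaM /= -linearN /= !mul1r.
rewrite (_ : setsym [set j] [set i] = setsym [set i] [set j]); last first.
  by apply/finset.setP => x; rewrite !in_setsym addbC.
congr twdelta.
have invE (k l : 'I_q) : odd #|inversions [set k] [set l]| = (l < k)%N.
  case: ltnP => lk.
    rewrite (_ : inversions _ _ = [set (k, l)]) ?cards1 //; apply/finset.setP => -[x y].
    by rewrite !inE /= xpair_eqE; case: eqP => // ->; case: eqP => // ->; rewrite lk.
  rewrite (_ : inversions _ _ = finset.set0) ?cards0 //; apply/finset.setP => -[x y].
  by rewrite !inE /=; case: eqP => // ->; case: eqP => // ->; rewrite ltnNge lk.
by rewrite !invE; move: ne; rewrite -val_eqE /=; case: ltngtP => //= _ _; rewrite ?opprK.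
Qed.

End Clifford.

Record zhom (gT : finGroupType) := ZHom {
  zh :> gT -> bool;
  zhM : forall g g', zh (g * g')%g = zh g (+) zh g'
}.

Lemma zhom_add_subproof (gT : finGroupType) (f f' : zhom gT) (g g' : gT) :
  f (g * g')%g (+) f' (g * g')%g = (f g (+) f' g) (+) (f g' (+) f' g').
Proof. by rewrite !zhM addbACA. Qed.
Definition zhom_add (gT : finGroupType) (f f' : zhom gT) : zhom gT :=
  @ZHom gT (fun g => f g (+) f' g) (zhom_add_subproof f f').

Section ComplexAlg.
Variable R : rcfType.
Local Notation C := (Rcomplex R).

Fact Rcomplex_scalerAr (a : R) (x y : C) : a *: (x * y) = x * (a *: y).
Proof. by rewrite mulrC scalerAl mulrC. Qed.
HB.instance Definition _ := GRing.Lalgebra_isAlgebra.Build R C Rcomplex_scalerAr.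

Definition Rcomplex_pair (x : C) : R^o * R^o := (complex.Re x, complex.Im x).
Fact Rcomplex_pair_linear : linear Rcomplex_pair.
Proof. by move=> k [a b] [c d]. Qed.
Fact Rcomplex_pair_bij : bijective Rcomplex_pair.
Proof. by exists (fun p : R^o * R^o => (Complex p.1 p.2 : C)) => [[a b]|[a b]]. Qed.
HB.instance Definition _ := Lmodule_hasFinDim.Build R C
  (vect_transport Rcomplex_pair_linear Rcomplex_pair_bij).
HB.instance Definition _ := GRing.UnitRing.on C.
End ComplexAlg.

Section GroupAlgebra.
Variables (R : rcfType) (gT : finGroupType) (s : zhom gT).
Local Notation C := (Rcomplex R).

(* ^g z *)
Definition gconj (g : gT) (z : R[i]) : R[i] := if s g then conjc z else z.

(* Normalized U(1)-valued 2-cocycles for the action of G through s. *)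
Record cocycle := Cocycle {
  coc :> gT -> gT -> R[i];
  coc_norm : forall g g', `|coc g g'| = 1;
  coc_1l : forall g, coc 1%g g = 1;
  coc_1r : forall g, coc g 1%g = 1;
  cocP : forall g g' g'',
    gconj g (coc g' g'') * coc g (g' * g'')%g = coc g g' * coc (g * g')%g g''
}.

Lemma zhom1 (f : zhom gT) : f 1%g = false.
Proof. by have := zhM f 1%g 1%g; rewrite mulg1; case: (f _). Qed.

Program Definition group_twist (w : cocycle) (h : zhom gT) :
    twist (C : falgType R) gT :=
  @Twist R C gT (fun g g' => (g * g')%g) 1%g gconj w h
    (@mulgA gT) (@mul1g gT) (@mulg1 gT) _ _ _ _ _ _ (coc_1l w) (coc_1r w) (cocP w) (zhM h).
Next Obligation. by move=> a x y; rewrite /gconj; case: (s g); rewrite ?linearP. Qed.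
Next Obligation. by move=> x y; rewrite /gconj; case: (s g); rewrite ?rmorphM. Qed.
Next Obligation. by rewrite /gconj rmorph1 if_same. Qed.
Next Obligation. by rewrite /gconj zhom1. Qed.
Next Obligation. by rewrite /gconj zhM; case: (s g) (s g') => [] []; rewrite ?conjcK. Qed.
Next Obligation. by rewrite mulrC. Qed.

(* C[G, w, s] graded by h *)
Definition tga (w : cocycle) (h : zhom gT) : superAlgType R := twalg (group_twist w h).

Definition tga_g (w : cocycle) (h : zhom gT) (g : gT) : tga w h :=
  twdelta (group_twist w h) g 1.
Definition tga_z (w : cocycle) (h : zhom gT) (z : R[i]) : tga w h :=
  twdelta (group_twist w h) 1%g z.

End GroupAlgebra.

(* Orthogonal representations on V = R^q, acting on column vectors. *)
Record orthrep (R : fieldType) (gT : finGroupType) (q : nat) := OrthRep {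
  orho :> gT -> 'M[R]_q;
  orho_orth : forall g, (orho g)^T *m orho g = 1%:M;
  orhoM : forall g g', orho (g * g')%g = orho g *m orho g'
}.

Section SeparationOfVariables.
Variables (R : rcfType) (gT : finGroupType) (q : nat) (V : orthrep R gT q).

Lemma det_rho_sqr g : \det (V g) ^+ 2 = 1.
Proof. by rewrite expr2 -{1}det_tr -det_mulmx orho_orth det1. Qed.

Definition odet (g : gT) : bool := \det (V g) == -1.

Lemma odetP g : \det (V g) = (-1) ^+ odet g.
Proof.
rewrite /odet; have /eqP := det_rho_sqr g; rewrite sqrf_eq1.
by case/orP => /eqP ->; rewrite ?eqxx // -addr_eq0 -(natrD _ 1 1) pnatr_eq0.
Qed.

Lemma odetM g g' : odet (g * g')%g = odet g (+) odet g'.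
Proof.
by apply: (@signr_inj R); rewrite -odetP orhoM det_mulmx !odetP signr_addb.
Qed.

Definition ohom : zhom gT := ZHom odetM.

(* Lifts of the rho(g) to Pin, with the Z_2-valued function omQ measuring their
   failure to be multiplicative. *)
Record pinlift := PinLift {
  pinl :> gT -> Cl R q;
  lift_pin : forall g, in_pin (pinl g);
  lift_cover : forall g, exists2 d, homog d (pinl g) &
    forall v, (-1) ^+ d *: (pinl g * clvec v * (pinl g)^-1) = clvec (V g *m v);
  lift_1 : pinl 1%g = 1;
  omQ : gT -> gT -> bool;
  omQP : forall g g', pinl g * pinl g' = (-1) ^+ omQ g g' *: pinl (g * g')%g
}.

Section Omega'.
Variables (s h : zhom gT) (w : cocycle R s) (L : pinlift).

Definition ho : zhom gT := zhom_add h ohom.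

Lemma lift_neq0 g : L g != 0.
Proof.
apply/eqP => L0; have := omQP L g g^-1%g; rewrite L0 mul0r mulgV lift_1.
by move/esym/eqP; rewrite scaler_eq0 signr_eq0 oner_eq0.
Qed.

Lemma sign_scale_inj (b b' : bool) g :
  (-1) ^+ b *: L g = (-1) ^+ b' *: L g -> b = b'.
Proof.
move/eqP; rewrite -subr_eq0 -scalerBl scaler_eq0 (negPf (lift_neq0 g)) orbF subr_eq0.
by move/eqP/signr_inj.
Qed.

Lemma omQ_coc g g' g'' :
  omQ L g' g'' (+) omQ L g (g' * g'')%g = omQ L g g' (+) omQ L (g * g')%g g''.
Proof.
have := mulrA (L g) (L g') (L g''); rewrite !omQP -scalerAl -scalerAr !omQP.
by rewrite !scalerA -!signr_addb mulgA => /sign_scale_inj.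
Qed.

Definition omega'_sign g g' : bool := omQ L g g' (+) (ho g && ohom g').

Program Definition omega' : cocycle R s :=
  @Cocycle R gT s (fun g g' => w g g' * (-1) ^+ omega'_sign g g') _ _ _ _.
Next Obligation. by rewrite normrM coc_norm normr_sign mulr1. Qed.
Next Obligation.
rewrite coc_1l mul1r /omega'_sign zhom1 addbF.
have := omQP L 1%g g; rewrite lift_1 mul1r mul1g -{1}[L g]scale1r.
by move/(@sign_scale_inj false) => <-.
Qed.
Next Obligation.
rewrite coc_1r mul1r /omega'_sign zhom1 andbF addbF.
have := omQP L g 1%g; rewrite lift_1 mulr1 mulg1 -{1}[L g]scale1r.
by move/(@sign_scale_inj false) => <-.
Qed.
Next Obligation.
have conjS (b : bool) : gconj s g ((-1) ^+ b) = (-1) ^+ b.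
  by rewrite /gconj; case: (s g) => //; rewrite rmorph_sign.
have conjM x y : gconj s g (x * y) = gconj s g x * gconj s g y.
  by rewrite /gconj; case: (s g) => //; rewrite rmorphM.
rewrite conjM conjS mulrACA cocP -signr_addb [RHS]mulrACA -signr_addb.
congr (_ * _ ^+ nat_of_bool _).
rewrite /omega'_sign addbACA omQ_coc [RHS]addbACA; congr (_ (+) _).
rewrite !zhM; case: (ho g) (ho g') (ohom g') (ohom g'') => [] [] [] [] //=.
Qed.

End Omega'.
End SeparationOfVariables.

Section TheAlgebraAV.
Variables (R : rcfType) (gT : finGroupType) (s h : zhom gT) (w : cocycle R s).
Variables (q : nat) (V : orthrep R gT q).
Local Notation A := (tga w h).

Definition AV_relations (C : algType R) (f : {lrmorphism A -> C}) (e : 'I_q -> C) : Prop :=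
  [/\ forall i, e i * e i = 1,
      forall i j, i != j -> e i * e j = - (e j * e i),
      forall i z, e i * f (tga_z w h z) = f (tga_z w h z) * e i
    & forall g i, (-1) ^+ h g *: (f (tga_g w h g) * e i * f (tga_g w h g)^-1) =
                  \sum_k V g k i *: e k].

(* AV is the real algebra generated by A and the e i with the above relations,
   as a universal property, with the grading extending that of A for which the
   e i are odd. *)
Record is_AV (AV : superAlgType R) (iota : gahom A AV) (e : 'I_q -> AV) : Prop := IsAV {
  AV_rel : AV_relations iota e;
  AV_univ : forall (C : algType R) (f : {lrmorphism A -> C}) (e' : 'I_q -> C),
    AV_relations f e' -> exists F : {lrmorphism AV -> C},
      [/\ forall x, F (iota x) = f x, forall i, F (e i) = e' i &
          forall F' : {lrmorphism AV -> C},
            (forall x, F' (iota x) = f x) -> (forall i, F' (e i) = e' i) -> F' =1 F];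
  AV_odd : forall i, homog true (e i)
}.

End TheAlgebraAV.

(* Finite-dimensional graded modules, as matrix representations in a homogeneous
   basis: the j-th basis vector has degree gmdeg j. *)
Record gmod (R : fieldType) (B : superAlgType R) := GMod {
  gmdim : nat;
  gmdeg : 'I_gmdim -> bool;
  gmact : {linear B -> 'M[R]_gmdim};
  gmact1 : gmact 1 = 1%:M;
  gmactM : forall x y, gmact (x * y) = gmact x *m gmact y;
  gmact_homog : forall d x, homog d x ->
    forall k j, gmdeg k != d (+) gmdeg j -> gmact x k j = 0
}.

Section GradedModules.
Variables (R : fieldType) (B : superAlgType R).
Implicit Types M N : gmod B.

(* Homomorphisms preserve the degree, so S and its parity shift are in general
   not isomorphic. *)
Definition ghom M N (f : 'M[R]_(gmdim N, gmdim M)) : Prop :=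
  (forall x, f *m gmact M x = gmact N x *m f) /\
  (forall k j, gmdeg k != gmdeg j -> f k j = 0).

Definition giso M N : Prop :=
  exists (f : 'M[R]_(gmdim N, gmdim M)) (g : 'M[R]_(gmdim M, gmdim N)),
    [/\ ghom f, ghom g, f *m g = 1%:M & g *m f = 1%:M].

Definition gsub M (U : {vspace 'cV[R]_(gmdim M)}) : Prop :=
  (forall x v, v \in U -> gmact M x *m v \in U) /\
  (forall d v, v \in U -> (\col_j (if gmdeg j == d then v j 0 else 0)) \in U).

Definition girr M : Prop :=
  (0 < gmdim M)%N /\ forall U, @gsub M U -> U = 0%VS \/ U = fullv.

(* N is the direct sum of the M j, as a biproduct *)
Definition gdsum N (k : nat) (M : 'I_k -> gmod B) : Prop :=
  exists (f : forall j, 'M[R]_(gmdim N, gmdim (M j)))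
         (p : forall j, 'M[R]_(gmdim (M j), gmdim N)),
    [/\ forall j, ghom (f j), forall j, ghom (p j),
        forall j, p j *m f j = 1%:M,
        forall i j, i != j -> p i *m f j = 0
      & \sum_j f j *m p j = 1%:M].

Lemma ghom1 M : @ghom M M 1%:M.
Proof.
split=> [x|k j ne]; first by rewrite mul1mx mulmx1.
by rewrite mxE; case: (k =P j) ne => // ->; rewrite eqxx.
Qed.

Lemma ghom_comp M N P (f : 'M[R]_(gmdim N, gmdim M)) (g : 'M[R]_(gmdim P, gmdim N)) :
  ghom f -> ghom g -> @ghom M P (g *m f).
Proof.
move=> [fx fd] [gx gd]; split=> [x|k j ne]; first by rewrite mulmxA -gx -!mulmxA fx.
rewrite mxE big1 // => l _; have [e|e] := eqVneq (gmdeg k) (gmdeg l).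
  by rewrite fd ?mulr0 // -e.
by rewrite gd // mul0r.
Qed.

Lemma giso_refl M : giso M M.
Proof. by exists 1%:M, 1%:M; rewrite mulmx1; split=> //; apply: ghom1. Qed.

Lemma giso_sym M N : giso M N -> giso N M.
Proof. by move=> [f [g [? ? ? ?]]]; exists g, f; split. Qed.

Lemma giso_trans M N P : giso M N -> giso N P -> giso M P.
Proof.
move=> [f [g [hf hg fg gf]]] [f' [g' [hf' hg' fg' gf']]]; exists (f' *m f), (g *m g').
split; try exact: ghom_comp.
  by rewrite mulmxA -(mulmxA f') fg mulmx1.
by rewrite mulmxA -(mulmxA g) gf' mulmx1.
Qed.

(* N(B): isomorphism classes of irreducible graded modules, and the free abelian
   group on them *)
Record irrmod_ := IrrMod { irr_mod :> gmod B; irr_girr : girr irr_mod }.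
Definition irrmod := {classic irrmod_}.

Definition irr_equiv (M N : irrmod) : bool := `[< giso (M : irrmod_) (N : irrmod_) >].

Lemma irr_equiv_is_equiv : equiv_class_of irr_equiv.
Proof.
split=> [M|M N|N M P].
- exact/asboolP/giso_refl.
- by apply/asboolP/asboolP; apply: giso_sym.
- move=> /asboolP MN /asboolP NP; exact/asboolP/(giso_trans MN NP).
Qed.
Canonical irr_equiv_equiv := EquivRelPack irr_equiv_is_equiv.
Canonical irr_equiv_encModRel := defaultEncModRel irr_equiv.

Definition irrclass := {eq_quot irr_equiv}.
HB.instance Definition _ := Choice.on irrclass.
HB.instance Definition _ : EqQuotient irrmod irr_equiv irrclass := EqQuotient.on irrclass.

Definition Ngrp := {freeg irrclass / int}.

Definition irrcls (S : irrmod_) : irrclass := \pi_irrclass (S : irrmod).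

(* N ~ S_1 + .. + S_k with S_j irreducible has class [S_1] + .. + [S_k]; the default
   0 only occurs for modules that are not semisimple. *)
Definition has_ncls N (x : Ngrp) : Prop :=
  exists (k : nat) (S : 'I_k -> irrmod_),
    gdsum N S /\ x = \sum_j << irrcls (S j) >>.
Definition ncls N : Ngrp := xget 0 [set x | has_ncls N x]%classic.

End GradedModules.

Section Pull.
Variables (R : fieldType) (B B' : superAlgType R) (f : gahom B B') (M : gmod B').

Definition gpull_act (x : B) : 'M[R]_(gmdim M) := gmact M (f x).
Fact gpull_linear : linear gpull_act.
Proof. by move=> k x y; rewrite /gpull_act !linearP. Qed.
HB.instance Definition _ :=
  GRing.isLinear.Build R B 'M[R]_(gmdim M) _ gpull_act gpull_linear.
Fact gpull_act1 : gpull_act 1 = 1%:M.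
Proof. by rewrite /gpull_act rmorph1 gmact1. Qed.
Fact gpull_actM x y : gpull_act (x * y) = gpull_act x *m gpull_act y.
Proof. by rewrite /gpull_act rmorphM gmactM. Qed.
Fact gpull_homog d x : homog d x ->
  forall k j, @gmdeg _ _ M k != d (+) @gmdeg _ _ M j -> gpull_act x k j = 0.
Proof. by move=> hx; apply: gmact_homog; rewrite /homog -gah_hpart hx. Qed.

Definition gpull : gmod B := GMod gpull_act1 gpull_actM gpull_homog.
End Pull.

(* A(B), the cokernel of N(Cl^{0,1} (x) B) -> N(B). *)
Section Acoker.
Variables (R : fieldType) (B : superAlgType R).
Local Notation ClB := (stens (Cl R 1) B : superAlgType R).

Definition restr : Ngrp ClB -> Ngrp B :=
  fglift (fun c : irrclass ClB =>
    ncls (gpull (gsinr (Cl R 1) B) (repr c : irrmod_ ClB)) : Ngrp B).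

Definition restr_im : {pred Ngrp B} := fun x => `[< exists y, x = restr y >].

Fact restr_im_zmod : zmod_closed restr_im.
Proof.
have restrB : zmod_morphism restr by exact: lift_is_additive.
split=> [|x y /asboolP[x' ->] /asboolP[y' ->]]; apply/asboolP.
  by exists 0; have := restrB 0 0; rewrite !subrr.
by exists (x' - y'); rewrite restrB.
Qed.
HB.instance Definition _ := GRing.isZmodClosed.Build (Ngrp B) restr_im restr_im_zmod.

Definition Acoker : zmodType := Quotient.quot restr_im.

Definition acls (N : gmod B) : Acoker := \pi_(Quotient.quot restr_im) (ncls N).
End Acoker.

(* S is, up to isomorphism, inflated along pi : B -> B'. *)
Definition belongs (R : fieldType) (B B' : superAlgType R) (pi : gahom B B')
    (S : gmod B) : Prop :=
  exists M : gmod B', giso S (gpull pi M).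

(* comp is the family of projections of the decomposition of A(B) into the direct
   sum of the A(B' j) given by the projections pi j of B = prod_j B' j: the
   inclusion A(B' j) -> A(B) is [M] |-> [gpull (pi j) M]. *)
Definition is_Acoker_dsum (R : fieldType) (B : superAlgType R) (J : finType)
    (B' : J -> superAlgType R) (pi : forall j, gahom B (B' j))
    (comp : forall j, {additive Acoker B -> Acoker (B' j)}) : Prop :=
  [/\ forall j (M : gmod (B' j)), comp j (acls (gpull (pi j) M)) = acls M,
      forall j k (M : gmod (B' k)), j != k -> comp j (acls (gpull (pi k) M)) = 0
    & forall y : (forall j, Acoker (B' j)),
        exists! x : Acoker B, forall j, comp j x = y j].

(* Main.v *)
From HB Require Import structures.
Require Import Defs.
From mathcomp Require Import all_boot all_order all_fingroup all_algebra.
From mathcomp Require Import generic_quotient ring_quotient falgebra.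
From mathcomp Require Import boolp classical_sets reals complex.
From mathcomp.multinomials Require Import freeg.

(** Central even idempotents of a graded algebra control its block decomposition.
    Conjugating by the generators of Cl^{0,q} shows that an even central element of
    Cl^{0,q} (x) B is 1 (x) b with b even and central in B.  Hence the a_i are exactly
    the block idempotents of A^V, which gives the bijection of the components.

    Graded modules over a graded Wedderburn product are semisimple: they are spanned
    by homogeneous vectors fixed by the primitive idempotents e_00 of the blocks, and
    such a vector generates a minimal submodule.  An irreducible module is killed by
    all block idempotents but one, both over A^V and over Cl^{0,1} (x) A^V, and this
    splits the cokernel A(A^V).

    On a simple block with graded division algebra D, the supertrace of e_00 is
    additive and vanishes on every module that extends to Cl^{0,1}, because the odd
    involution exchanges the even and the odd part.  If the summand is Z_2 then twice
    the class of a simple module S is 0, so the supertrace of e_00 on S is 0 and e_00 S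
    contains an even vector.  Therefore all simple modules of the block are
    isomorphic and represent the generator, and Tr(a_i) / n_i counts those occurring
    in N. *)

Set Implicit Arguments.
Unset Strict Implicit.
Unset Printing Implicit Defensive.

Import Order.TTheory GRing.Theory Num.Theory.
Local Open Scope ring_scope.
Local Open Scope quotient_scope.

(** * Graded matrices and graded modules *)

Section GradedMatrices.
Variable R : fieldType.

(** Projection onto the degree [d] part. Homogeneity is handled through identities between these
    projections rather than through matrix entries. *)
Definition gpr n (dg : 'I_n -> bool) (d : bool) : 'M[R]_n :=
  diag_mx (\row_j (dg j == d)%:R).

Lemma gpr_mull m n dg d (A : 'M[R]_(m, n)) i j :
  (gpr dg d *m A) i j = if dg i == d then A i j else 0.
Proof. by rewrite mul_diag_mx !mxE; case: eqP => _; rewrite ?mul1r ?mul0r. Qed.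

Lemma gpr_mulr m n dg d (A : 'M[R]_(m, n)) i j :
  (A *m gpr dg d) i j = if dg j == d then A i j else 0.
Proof. by rewrite mul_mx_diag !mxE; case: eqP => _; rewrite ?mulr1 ?mulr0. Qed.

Lemma gpr_sum n (dg : 'I_n -> bool) : gpr dg false + gpr dg true = 1%:M.
Proof.
apply/matrixP => i j; rewrite -[gpr dg false]mulmx1 -[gpr dg true]mulmx1.
by rewrite mxE !gpr_mull; case: (dg i); rewrite ?addr0 ?add0r.
Qed.

Lemma gprM n (dg : 'I_n -> bool) d d' :
  gpr dg d *m gpr dg d' = if d == d' then gpr dg d else 0.
Proof.
apply/matrixP => i j; rewrite gpr_mull -[gpr dg d']mulmx1 gpr_mull.
case: (eqVneq d d') => [<-|ne]; first by rewrite -[in RHS](mulmx1 (gpr dg d)) gpr_mull; case: eqP.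
by rewrite [RHS]mxE; case: eqP => // ->; rewrite (negPf ne).
Qed.

(** Replaces the entrywise homogeneity in [gmod] and [ghom] by an intertwining identity, which is
    stable under products. *)
Lemma gpr_commP m n dm dn (A : 'M[R]_(m, n)) d :
  (forall k j, dm k != d (+) dn j -> A k j = 0) <->
  (forall e, A *m gpr dn e = gpr dm (d (+) e) *m A).
Proof.
split=> [A0 e|AC k j].
  apply/matrixP => k j; rewrite gpr_mull gpr_mulr.
  move: (A0 k j) => {A0}; case: (dm k) (dn j) d e => [] [] [] [] //= -> //.
move/negPf => ne; have /matrixP/(_ k j) := AC (dn j).
by rewrite gpr_mull gpr_mulr eqxx ne.
Qed.

Lemma linear_colP m n (g : {linear 'cV[R]_n -> 'cV[R]_m}) :
  exists G : 'M_(m, n), forall v, g v = G *m v.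
Proof.
exists (\matrix_(i, j) g (delta_mx j 0) i 0) => v.
rewrite {1}(matrix_sum_delta v) linear_sum; apply/colP => i.
rewrite summxE mxE; apply: eq_bigr => j _.
by rewrite big_ord1 linearZ !mxE mulrC.
Qed.

Lemma mulmx_col_inj m n (A B : 'M[R]_(m, n)) :
  (forall v : 'cV_n, A *m v = B *m v) -> A = B.
Proof.
move=> e; apply/matrixP => i j; have /colP/(_ i) := e (delta_mx j 0).
by rewrite -!colE !mxE.
Qed.

Lemma mulmx_col_surj m n (A : 'M[R]_(m, n)) :
  (forall v, exists w : 'cV_n, v = A *m w) -> exists B, A *m B = 1%:M.
Proof.
move=> sur; pose w j := projT1 (cid (sur (delta_mx j 0))).
have wP j : delta_mx j 0 = A *m w j := projT2 (cid (sur (delta_mx j 0))).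
exists (\matrix_(i, j) w j i 0); apply/matrixP => i j.
have /colP/(_ i) := wP j; rewrite !mxE eqxx andbT => ->.
by apply: eq_bigr => k _; rewrite mxE.
Qed.

(** Take a full-rank factorisation [p = C Q]. In [C Q C Q = C Q] the factor [C] cancels on the left
    and [Q] on the right, leaving [Q C = 1]. *)
Lemma mx_idem_split n (p : 'M[R]_n) : p *m p = p ->
  exists r (C : 'M_(n, r)) (Q : 'M_(r, n)), C *m Q = p /\ Q *m C = 1%:M.
Proof.
move=> pp; exists (\rank p), (col_base p), (row_base p); split; first exact: mulmx_base.
apply: (row_full_inj (col_base_full p)); apply: (row_free_inj (row_base_free p)).
by rewrite mulmx1 mulmx_base mulmxA mulmx_base -mulmxA mulmx_base.
Qed.

End GradedMatrices.

(** * Graded homomorphisms, Schur's lemma and direct sums *)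

Section Modules.
Variables (R : fieldType) (B : superAlgType R).
Implicit Types M N P : gmod B.

Local Notation gP M := (gpr R (@gmdeg R B M)).

Lemma ghomP M N (f : 'M[R]_(gmdim N, gmdim M)) :
  ghom f <-> (forall x, f *m gmact M x = gmact N x *m f) /\
             (forall e, f *m gP M e = gP N e *m f).
Proof.
have := gpr_commP (@gmdeg _ _ N) (@gmdeg _ _ M) f false.
by rewrite /ghom => -[h1 h2]; split=> -[fx fd]; split=> //; [exact: h1|exact: h2].
Qed.

Lemma gmact_gpr M d x e : homog d x -> gmact M x *m gP M e = gP M (d (+) e) *m gmact M x.
Proof. by move=> hx; apply/(gpr_commP _ _ _ d): e; apply: gmact_homog. Qed.

(** The block of an operator from degree [d] to degree [e] only sees the component of [x] of degree
    [e + d]. *)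
Lemma gmact_hpart M d e x :
  gP M e *m gmact M x *m gP M d = gmact M (hpart (e (+) d) x) *m gP M d.
Proof.
have xE : gmact M x = gmact M (hpart (e (+) d) x) + gmact M (hpart (~~ (e (+) d)) x).
  by rewrite -linearD -[LHS](congr1 _ (hpart_sum x)); case: (e (+) d) => //; rewrite addrC.
rewrite xE mulmxDr mulmxDl -!mulmxA !(gmact_gpr _ _ (homog_hpart _ _)) !mulmxA !gprM.
by case: e d {xE} => [] []; rewrite /= mul0mx addr0.
Qed.

Lemma gsubP M (U : {vspace 'cV[R]_(gmdim M)}) :
  gsub U <-> (forall x v, v \in U -> gmact M x *m v \in U) /\
             (forall d v, v \in U -> gP M d *m v \in U).
Proof.
have E d (v : 'cV_(gmdim M)) : \col_j (if gmdeg j == d then v j 0 else 0) = gP M d *m v.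
  by apply/colP => j; rewrite mxE gpr_mull.
by rewrite /gsub; split=> -[h1 h2]; split=> // d v vU; [rewrite -E|rewrite E]; apply: h2.
Qed.

Lemma ghom_split N (p : 'M_(gmdim N)) : @ghom _ _ N N p -> p *m p = p ->
  exists (S : gmod B) (f : 'M[R]_(gmdim N, gmdim S)) (g : 'M[R]_(gmdim S, gmdim N)),
    [/\ ghom f, ghom g, g *m f = 1%:M & f *m g = p].
Proof.
move=> /ghomP[px pd] pp.
(* [p] preserves degrees, so it is split in each degree separately; the columns of [f] below then
   form a homogeneous basis of the image. *)
pose pi d := gP N d *m p.
have piE d : p *m gP N d = pi d by rewrite pd.
have piM d e : pi d *m pi e = if d == e then pi d else 0.
  rewrite /pi mulmxA -[_ *m p *m gP N e]mulmxA pd !mulmxA gprM.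
  by case: eqP => _; rewrite ?mul0mx // -mulmxA pp.
have pi_sum : pi false + pi true = p by rewrite -mulmxDl gpr_sum mul1mx.
have /all_tag[m /all_tag[C /all_sig2[Q CQ QC1]]] : forall d, {m & {C : 'M_(gmdim N, m) &
    {Q : 'M_(m, gmdim N) | C *m Q = pi d & Q *m C = 1%:M}}}.
  move=> d; have pid : pi d *m pi d = pi d by rewrite piM eqxx.
  have [m e] := cid (mx_idem_split pid); exists m.
  have [C {}e] := cid e; exists C; have [Q [CQ QC]] := cid e; by exists Q.
have QC0 d e : d != e -> Q d *m C e = 0.
  move=> /negPf ne; rewrite -[LHS]mul1mx -(QC1 d) -[LHS]mulmx1 -(QC1 e) -!mulmxA.
  rewrite (mulmxA (C e)) CQ (mulmxA (C d)) CQ.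
  by rewrite (mulmxA (pi d)) piM ne mul0mx mulmx0.
have piC d : pi d *m C d = C d by rewrite -CQ -mulmxA QC1 mulmx1.
have Qpi d : Q d *m pi d = Q d by rewrite -CQ mulmxA QC1 mul1mx.
pose f : 'M[R]_(gmdim N, m false + m true) := row_mx (C false) (C true).
pose g : 'M[R]_(m false + m true, gmdim N) := col_mx (Q false) (Q true).
have fg : f *m g = p by rewrite mul_row_col !CQ.
have gf : g *m f = 1%:M.
  by rewrite mul_col_row !QC1 !QC0 // -scalar_mx_block.
(* The first block of basis vectors spans the even part of the image, the second the odd part. *)
pose dg (i : 'I_(m false + m true)) := if split i is inl _ then false else true.
pose act x := g *m gmact N x *m f.
have act_lin : linear act.
  by move=> k x y; rewrite /act linearP mulmxDr mulmxDl -scalemxAr -scalemxAl.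
pose actL : {linear B -> 'M[R]_(m false + m true)} :=
  HB.pack act (GRing.isLinear.Build _ _ _ _ act act_lin).
have PC d a : gP N d *m C a = if a == d then C a else 0.
  rewrite -{1}(piC a) !mulmxA gprM eq_sym.
  by case: eqP => [->|_]; rewrite ?mul0mx // -/(pi d) piC.
have PQ d a : Q a *m gP N d = if a == d then Q a else 0.
  rewrite -{1}(Qpi a) -mulmxA -[pi a *m _]mulmxA pd (mulmxA (gP N a)) gprM.
  by case: eqP => _; rewrite ?mul0mx ?mulmx0 // Qpi.
have fP d : f *m gpr R dg d = gP N d *m f.
  apply/matrixP => i j; rewrite gpr_mulr mul_mx_row !PC /dg !mxE.
  by case: (split j) => k; case: d; rewrite //= mxE.
have gPd d : g *m gP N d = gpr R dg d *m g.
  apply/matrixP => i j; rewrite gpr_mull mul_col_mx !PQ /dg !mxE.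
  by case: (split i) => k; case: d; rewrite //= mxE.
have act1 : actL 1 = 1%:M by rewrite /= /act gmact1 mulmx1.
have pf : p *m f = f by rewrite -fg -mulmxA gf mulmx1.
have gp : g *m p = g by rewrite -fg mulmxA gf mul1mx.
have fact x : f *m act x = gmact N x *m f.
  by rewrite /act !mulmxA fg px -mulmxA pf.
have actg x : act x *m g = g *m gmact N x.
  by rewrite /act -mulmxA fg -!mulmxA -px mulmxA gp.
have actM x y : actL (x * y) = actL x *m actL y.
  rewrite /= [act y]/act -mulmxA mulmxA actg mulmxA.
  by rewrite /act gmactM !mulmxA.
have acth d x : homog d x -> forall k j, dg k != d (+) dg j -> actL x k j = 0.
  move=> hx; apply/gpr_commP => e; rewrite /= /act -!mulmxA fP.
  by rewrite [in LHS](mulmxA (gmact N x)) (gmact_gpr _ _ hx) !mulmxA gPd.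
exists (GMod act1 actM acth), f, g; split=> //; apply/ghomP; split=> //= x.
Qed.

Lemma memv_kermulmx (k n : nat) (G : 'M[R]_(k, n)) (v : 'cV_n) :
  (v \in lker (linfun (mulmx G))) = (G *m v == 0).
Proof. by rewrite memv_ker lfunE. Qed.

Lemma memv_imgmulmx (k n : nat) (G : 'M[R]_(k, n)) (U : {vspace 'cV[R]_n}) (v : 'cV_k) :
  reflect (exists2 w : 'cV_n, w \in U & v = G *m w) (v \in (linfun (mulmx G) @: U)%VS).
Proof.
by apply: (iffP memv_imgP) => -[w wU ->]; exists w; rewrite ?lfunE.
Qed.

Lemma ghom_gsub_ker M N (f : 'M[R]_(gmdim N, gmdim M)) : ghom f ->
  gsub (lker (linfun (mulmx f) : 'Hom('cV[R]_(gmdim M), _))).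
Proof.
move=> /ghomP[fx fd]; apply/gsubP; split=> [x|d] v; rewrite !memv_kermulmx => /eqP fv.
  by rewrite mulmxA fx -mulmxA fv mulmx0.
by rewrite mulmxA fd -mulmxA fv mulmx0.
Qed.

Lemma ghom_gsub_img M N (f : 'M[R]_(gmdim N, gmdim M)) (U : {vspace 'cV[R]_(gmdim M)}) :
  ghom f -> gsub U -> gsub (linfun (mulmx f) @: U)%VS.
Proof.
move=> /ghomP[fx fd] /gsubP[Ux Ud]; apply/gsubP.
split=> [x|d] v /memv_imgmulmx[w wU ->]; apply/memv_imgmulmx.
  by exists (gmact M x *m w); rewrite ?Ux // mulmxA -fx mulmxA.
by exists (gP M d *m w); rewrite ?Ud // mulmxA -fd mulmxA.
Qed.

Lemma gsub_full M : gsub (fullv : {vspace 'cV[R]_(gmdim M)}).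
Proof. by split=> *; apply: memvf. Qed.

Lemma ghom_inv M N (f : 'M[R]_(gmdim N, gmdim M)) (g : 'M[R]_(gmdim M, gmdim N)) :
  ghom f -> f *m g = 1%:M -> g *m f = 1%:M -> ghom g.
Proof.
move=> /ghomP[fx fd] fg gf; apply/ghomP; split=> [x|e].
  by rewrite -[LHS]mulmx1 -fg mulmxA -(mulmxA g) -fx !mulmxA gf mul1mx.
by rewrite -[LHS]mulmx1 -fg mulmxA -(mulmxA g) -fd !mulmxA gf mul1mx.
Qed.

(** Schur's lemma: the kernel and the image of [f] are graded submodules, hence trivial or
    everything. *)
Lemma girr_schur M N (f : 'M[R]_(gmdim N, gmdim M)) :
  girr M -> girr N -> ghom f -> f != 0 ->
  exists g, [/\ ghom g, f *m g = 1%:M & g *m f = 1%:M].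
Proof.
move=> [_ irrM] [_ irrN] fh f0.
have ker0 (v : 'cV_(gmdim M)) : f *m v = 0 -> v = 0.
  move=> fv; case: (irrM _ (ghom_gsub_ker fh)) => kE.
    have : v \in (lker (linfun (mulmx f)) : {vspace 'cV[R]_(gmdim M)}) by rewrite memv_kermulmx fv.
    by rewrite kE memv0 => /eqP.
  case/eqP: f0; apply: mulmx_col_inj => w; rewrite mul0mx; apply/eqP.
  by rewrite -memv_kermulmx kE memvf.
have [g fg] : exists g, f *m g = 1%:M.
  apply: mulmx_col_surj => v; case: (irrN _ (ghom_gsub_img fh (gsub_full M))) => iE.
    case/eqP: f0; apply: mulmx_col_inj => w; rewrite mul0mx; apply/eqP.
    have : f *m w \in (linfun (mulmx f) @: fullv)%VS by apply/memv_imgmulmx; exists w; rewrite ?memvf.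
    by rewrite iE memv0.
  have /memv_imgmulmx[w _ ->] : v \in (linfun (mulmx f) @: fullv)%VS by rewrite iE memvf.
  by exists w.
have gf : g *m f = 1%:M.
  apply: mulmx_col_inj => v; apply/eqP; rewrite -subr_eq0; apply/eqP/ker0.
  by rewrite mulmxBr !mulmxA mulmx1 fg mul1mx subrr.
by exists g; split=> //; apply: ghom_inv gf.
Qed.

Lemma girr_neq0 M : girr M -> (1%:M : 'M[R]_(gmdim M)) != 0.
Proof.
move=> [M0 _]; apply/eqP => /matrixP/(_ (Ordinal M0) (Ordinal M0)).
by rewrite !mxE eqxx => /eqP; rewrite oner_eq0.
Qed.

Lemma giso_girr M N : giso M N -> girr M -> girr N.
Proof.
move=> [f [g [fh gh fg gf]]] irrM; case: (irrM) => M0 irr; split=> [|U gU].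
  rewrite lt0n; apply: contraTneq (girr_neq0 irrM) => N0.
  rewrite negbK -gf; apply/eqP; apply/matrixP => i j; rewrite !mxE big1 // => k _.
  by have := ltn_ord k; rewrite [X in (_ < X)%N]N0 ltn0.
have gK (v : 'cV_(gmdim N)) : f *m (g *m v) = v by rewrite mulmxA fg mul1mx.
case: (irr _ (ghom_gsub_img gh gU)) => E; [left|right].
  apply/eqP; rewrite -subv0; apply/subvP => v vU; rewrite memv0 -(gK v).
  suff: g *m v \in 0%VS by rewrite memv0 => /eqP ->; rewrite mulmx0.
  by rewrite -E; apply/memv_imgmulmx; exists v.
apply/eqP; rewrite eqEsubv subvf; apply/subvP => v _; rewrite -(gK v).
have /memv_imgmulmx[w wU ->] : g *m v \in (linfun (mulmx g) @: U)%VS by rewrite E memvf.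
by rewrite gK.
Qed.

Lemma irrcls_eq (S S' : irrmod_ B) : irrcls S = irrcls S' <-> giso S S'.
Proof.
split=> [|e]; first by move/eqquotP/asboolP.
by apply/eqquotP/asboolP.
Qed.

Lemma irrcls_repr (c : irrclass B) : irrcls (repr c : irrmod_ B) = c.
Proof. exact: reprK. Qed.

Lemma giso_repr (S : irrmod_ B) : giso (repr (irrcls S) : irrmod_ B) S.
Proof. by apply/irrcls_eq; rewrite irrcls_repr. Qed.

Lemma gdsum_giso N N' (k : nat) (S : 'I_k -> gmod B) :
  giso N N' -> gdsum N S -> gdsum N' S.
Proof.
move=> [u [v [uh vh uv vu]]] [f [p [fh ph pf pf0 fp]]].
exists (fun j => u *m f j), (fun j => p j *m v); split.
- by move=> j; apply: ghom_comp.
- by move=> j; apply: ghom_comp.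
- by move=> j; rewrite mulmxA -(mulmxA (p j)) vu mulmx1.
- by move=> i j ne; rewrite mulmxA -(mulmxA (p i)) vu mulmx1 pf0.
rewrite -uv -[u in RHS]mulmx1 -fp mulmx_sumr mulmx_suml; apply: eq_bigr => j _.
by rewrite !mulmxA.
Qed.

Lemma has_ncls_giso N N' x : giso N N' -> has_ncls N x -> has_ncls N' x.
Proof. by move=> i [k [S [d ->]]]; exists k, S; split=> //; apply: gdsum_giso d. Qed.

Lemma ncls_giso N N' : giso N N' -> ncls N = ncls N'.
Proof.
move=> i; rewrite /ncls; congr (xget _ _); apply/seteqP; split=> x.
  exact: has_ncls_giso.
by apply: has_ncls_giso; apply: giso_sym.
Qed.

(** An endomorphism natural in the module has additive trace: naturality moves it through the
    inclusions, and cyclicity of the trace cancels inclusion against projection. *)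
Lemma gdsum_tr N (k : nat) (S : 'I_k -> gmod B) (F : forall M, 'M[R]_(gmdim M)) :
  (forall M M' (f : 'M[R]_(gmdim M', gmdim M)), ghom f -> f *m F M = F M' *m f) ->
  gdsum N S -> \tr (F N) = \sum_j \tr (F (S j)).
Proof.
move=> Fh [f [p [fh _ pf _ fp]]]; rewrite -[F N]mulmx1 -fp mulmx_sumr linear_sum.
apply: eq_bigr => j _ /=; rewrite mulmxA -Fh // -mulmxA mxtrace_mulC -mulmxA pf.
by rewrite mulmx1.
Qed.

Lemma giso_tr M N (F : forall M, 'M[R]_(gmdim M)) :
  (forall M M' (f : 'M[R]_(gmdim M', gmdim M)), ghom f -> f *m F M = F M' *m f) ->
  giso M N -> \tr (F M) = \tr (F N).
Proof.
move=> Fh [f [g [fh gh fg gf]]].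
by rewrite -[F M]mul1mx -gf -mulmxA mxtrace_mulC Fh // -mulmxA fg mulmx1.
Qed.

End Modules.

Lemma sum_over_values (T : eqType) (V : nmodType) (k : nat) (cs : seq T)
    (t : 'I_k -> T) (F : 'I_k -> V) :
  uniq cs -> (forall j, t j \in cs) ->
  \sum_(c <- cs) \sum_(j | t j == c) F j = \sum_j F j.
Proof.
move=> ucs tcs; rewrite (exchange_big_dep predT) //=; apply: eq_bigr => j _.
rewrite -big_filter (_ : [seq c <- cs | _] = [:: t j]) ?big_seq1 //.
rewrite (eq_filter (a2 := pred1 (t j))) => [|c]; last by rewrite /= eq_sym.
by rewrite filter_pred1_uniq.
Qed.

(** * Uniqueness of the class of a module *)

Section Uniqueness.
Variables (R : numFieldType) (B : superAlgType R).
Implicit Types M N : gmod B.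

Lemma isotypic_trace N (k : nat) (S : 'I_k -> irrmod_ B)
    (f : forall j, 'M[R]_(gmdim N, gmdim (S j)))
    (p : forall j, 'M[R]_(gmdim (S j), gmdim N)) (c : irrclass B) :
  (forall j, p j *m f j = 1%:M) ->
  \tr (\sum_(j | irrcls (S j) == c) f j *m p j) =
  (#|[pred j | irrcls (S j) == c]| * gmdim (repr c : irrmod_ B))%:R.
Proof.
move=> pf; rewrite linear_sum -sum_nat_const natr_sum; apply: eq_bigr => j /eqP <- /=.
rewrite mxtrace_mulC pf -(mxtrace1 R (gmdim (repr _ : irrmod_ B))).
apply: (giso_tr (F := fun M => 1%:M)); last by apply: giso_sym; apply: giso_repr.
by move=> *; rewrite mulmx1 mul1mx.
Qed.

(* Both decompositions of N give the same idempotent onto each isotypic part,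
   by Schur's lemma; its trace counts the summands. *)
Lemma has_ncls_uniq N (x y : Ngrp B) : has_ncls N x -> has_ncls N y -> x = y.
Proof.
move=> [k [S [[f [p [fh ph pf _ fp]]] ->]]] [k' [S' [[f' [p' [fh' ph' pf' _ fp']]] ->]]].
pose E c := \sum_(j | irrcls (S j) == c) f j *m p j.
pose E' c := \sum_(j | irrcls (S' j) == c) f' j *m p' j.
pose cs := undup ([seq irrcls (S j) | j <- enum 'I_k] ++ [seq irrcls (S' j) | j <- enum 'I_k']).
have ucs : uniq cs by apply: undup_uniq.
have Scs j : irrcls (S j) \in cs by rewrite mem_undup mem_cat map_f // mem_enum.
have Scs' j : irrcls (S' j) \in cs by rewrite mem_undup mem_cat orbC map_f // mem_enum.
(* A nonzero [p i *m f' j] would identify irreducible modules of different classes. *)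
have EE' c c' : c != c' -> E c *m E' c' = 0.
  move=> ne; rewrite mulmx_suml big1 // => i /eqP ic.
  rewrite mulmx_sumr big1 // => j /eqP jc.
  rewrite -mulmxA (mulmxA (p i)); have [->|nz] := eqVneq (p i *m f' j) 0.
    by rewrite mul0mx mulmx0.
  have h := ghom_comp (fh' j) (ph i).
  have [g [gh e1 e2]] := girr_schur (irr_girr (S' j)) (irr_girr (S i)) h nz.
  case/eqP: ne; rewrite -ic -jc; apply/irrcls_eq/giso_sym.
  by exists (p i *m f' j), g.
have sumE : \sum_(c <- cs) E c = 1%:M by rewrite sum_over_values.
have sumE' : \sum_(c <- cs) E' c = 1%:M by rewrite sum_over_values.
have EqE c : c \in cs -> E c = E' c.
  move=> ccs; transitivity (E c *m E' c).
    rewrite -[LHS]mulmx1 -sumE' mulmx_sumr (bigD1_seq c) //= big1 ?addr0 // => c' ne.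
    by apply: EE'; rewrite eq_sym.
  rewrite -[RHS]mul1mx -sumE [RHS]mulmx_suml (bigD1_seq c) //= big1 ?addr0 // => c' ne.
  exact: EE'.
(* In characteristic 0 the multiplicity can be read off the trace, because an irreducible module has
   positive dimension. *)
have cardE c : c \in cs -> #|[pred j | irrcls (S j) == c]| = #|[pred j | irrcls (S' j) == c]|.
  move=> /EqE/(congr1 mxtrace); rewrite !isotypic_trace // => /eqP.
  by rewrite eqr_nat eqn_pmul2r ?(irr_girr (repr c : irrmod_ B)).1 // => /eqP.
have sumC n (T : 'I_n -> irrmod_ B) c : \sum_(j | irrcls (T j) == c) (<< irrcls (T j) >> : Ngrp B)
    = << c >> *+ #|[pred j | irrcls (T j) == c]|.
  by rewrite -sumr_const; apply: eq_bigr => j /eqP ->.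
rewrite -(sum_over_values (t := fun j => irrcls (S j)) _ ucs) //.
rewrite -[RHS](sum_over_values (t := fun j => irrcls (S' j)) _ ucs) //.
by apply: eq_big_seq => c ccs; rewrite !sumC cardE.
Qed.

Lemma has_ncls_ncls N x : has_ncls N x -> ncls N = x.
Proof.
move=> Nx; apply: (@has_ncls_uniq N) => //.
by rewrite /ncls; case: xgetP => [y -> //|/(_ x)].
Qed.

End Uniqueness.

(** * Semisimplicity *)

Section Semisimple.
Variables (R : numFieldType) (B : superAlgType R).
Implicit Types M N : gmod B.

Local Notation gP M := (gpr R (@gmdeg R B M)).

(** The last clause says that each nonzero homogeneous element of the left ideal [B e] generates it,
    so [B e] has no proper nonzero graded submodule. The value [e = 0] is allowed. *)
Definition gprimitive (e : B) : Prop :=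
  [/\ homog false e, e * e = e &
      forall d x, homog d x -> x * e != 0 -> exists y, y * x * e = e].

(** The unit lies in the two-sided ideal generated by primitive idempotents. Applied to a vector of
    any graded module, this writes it as a combination of vectors [l (e v)], which is all that
    complete reducibility needs. *)
Definition gsemisimple : Prop :=
  exists (K : finType) (l e r : K -> B),
    (forall k, gprimitive (e k)) /\ \sum_k l k * e k * r k = 1.

Definition primitive_vec N (v : 'cV[R]_(gmdim N)) : Prop :=
  exists e d, [/\ gprimitive e, gmact N e *m v = v & gP N d *m v = v].

Definition gorbit N (v : 'cV[R]_(gmdim N)) (x : B) : 'cV[R]_(gmdim N) := gmact N x *m v.
Fact gorbit_linear N v : linear (@gorbit N v).
Proof. by move=> k x y; rewrite /gorbit linearP mulmxDl -scalemxAl. Qed.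
HB.instance Definition _ N v :=
  GRing.isLinear.Build R B 'cV[R]_(gmdim N) _ (@gorbit N v) (@gorbit_linear N v).

Definition gcyclic N v : {vspace 'cV[R]_(gmdim N)} := limg (linfun (@gorbit N v)).

Lemma memv_gcyclic N v u : reflect (exists x, u = gmact N x *m v) (u \in gcyclic v).
Proof.
by apply: (iffP memv_imgP) => [[x _ ->]|[x ->]]; exists x; rewrite ?memvf // lfunE.
Qed.

Lemma gcyclic_self N v : v \in @gcyclic N v.
Proof. by apply/memv_gcyclic; exists 1; rewrite gmact1 mul1mx. Qed.

Lemma gcyclic_gsub N d (v : 'cV[R]_(gmdim N)) : gP N d *m v = v -> gsub (gcyclic v).
Proof.
move=> dv; apply/gsubP; split=> [x|e] u /memv_gcyclic[y ->]; apply/memv_gcyclic.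
  by exists (x * y); rewrite gmactM mulmxA.
exists (hpart (e (+) d) y); rewrite -{1}dv !mulmxA gmact_hpart -mulmxA.
by rewrite dv.
Qed.

(** A nonzero vector of [X] in the orbit of [v] has a nonzero homogeneous component [x v = x e v].
    Primitivity gives [y x e = e], so [v = y x v] lies in [X]. *)
Lemma primitive_vec_dichotomy N v (X : {vspace 'cV[R]_(gmdim N)}) :
  primitive_vec v -> gsub X -> v \in X \/ (X :&: gcyclic v = 0)%VS.
Proof.
move=> [e [d [[eh ee epr] ev dv]]] /gsubP[Xx Xd]; case: (boolP (v \in X)) => vX; first by left.
right; apply/eqP; rewrite -subv0; apply/subvP => u; rewrite memv_cap => /andP[uX].
move/memv_gcyclic => [x uE]; rewrite memv0; apply: contraNT vX => u0.
have [f fu] : exists f, gP N f *m u != 0.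
  case: (eqVneq (gP N false *m u) 0) => [f0|]; last by exists false.
  exists true; apply: contraNneq u0 => f1.
  by rewrite -[u]mul1mx -(gpr_sum R (@gmdeg _ _ N)) mulmxDl f0 f1 addr0.
have uE' : gP N f *m u = gmact N (hpart (f (+) d) x) *m v.
  by rewrite uE -{1}dv !mulmxA gmact_hpart -mulmxA dv.
have [|y yE] := epr _ _ (homog_hpart (f (+) d) x).
  apply: contraNneq fu => xe0.
  by rewrite uE' -ev mulmxA -gmactM xe0 linear0 mul0mx.
by rewrite -ev -yE -mulrA !gmactM -!mulmxA ev -uE' Xx // Xd.
Qed.

Lemma gsub_add N (U W : {vspace 'cV[R]_(gmdim N)}) :
  gsub U -> gsub W -> gsub (U + W)%VS.
Proof.
move=> [Ux Ud] [Wx Wd]; apply/gsubP.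
move: (Ux) (Wx) => _ _; have /gsubP[_ Ud'] : gsub U by split.
have /gsubP[_ Wd'] : gsub W by split.
split=> [x|d] _ /memv_addP[u uU [w wW ->]]; rewrite mulmxDr memv_add //.
- exact: Ux.
- exact: Wx.
- exact: Ud'.
exact: Wd'.
Qed.

Lemma gsub0 N : gsub (0%VS : {vspace 'cV[R]_(gmdim N)}).
Proof.
by apply/gsubP; split=> [x|d] v; rewrite memv0 => /eqP ->; rewrite mulmx0 mem0v.
Qed.

Hypothesis ssB : gsemisimple.

(** Write [v] as the sum of the [l e r v]. Since [e] is even, [e] applied to the even or odd part of
    [r v] is a primitive vector. *)
Lemma primitive_vec_span N (X : {vspace 'cV[R]_(gmdim N)}) :
  gsub X -> (forall v, primitive_vec v -> v \in X) -> X = fullv.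
Proof.
move=> /gsubP[Xx Xd] Xp; apply/eqP; rewrite eqEsubv subvf; apply/subvP => v _.
have [K [l [e [r [ep lerE]]]]] := ssB.
rewrite -[v]mul1mx -gmact1 -lerE linear_sum mulmx_suml memv_suml // => k _.
rewrite -mulrA !gmactM -mulmxA Xx // -[gmact N (r k)]mul1mx -(gpr_sum R (@gmdeg _ _ N)).
have [eh ee _] := ep k.
have eP d : gP N d *m gmact N (e k) *m gP N d = gmact N (e k) *m gP N d.
  by have /= EP := gmact_gpr N d eh; rewrite -mulmxA EP mulmxA gprM eqxx.
rewrite mulmxDl mulmxDr mulmxDl memvD //; apply: Xp; exists (e k).
  by exists false; rewrite !mulmxA -gmactM ee eP.
by exists true; rewrite !mulmxA -gmactM ee eP.
Qed.

(** Take [W] of maximal dimension among graded submodules meeting [U] trivially. A primitive vector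
    outside [U + W] would generate a submodule that could be added to [W]. *)
Lemma gsub_compl N (U : {vspace 'cV[R]_(gmdim N)}) : gsub U ->
  exists W, [/\ gsub W, (U :&: W = 0)%VS & (U + W)%VS = fullv].
Proof.
move=> gU.
pose P n := `[< exists W : {vspace 'cV[R]_(gmdim N)},
  [/\ gsub W, (U :&: W = 0)%VS & \dim W = n] >].
have exP : exists n, P n.
  by exists 0%N; apply/asboolP; exists 0%VS; rewrite capv0 dimv0; split=> //; apply: gsub0.
have ubP n : P n -> (n <= \dim (fullv : {vspace 'cV[R]_(gmdim N)}))%N.
  by move=> /asboolP[W [_ _ <-]]; apply/dimvS/subvf.
case: (ex_maxnP exP ubP) => n /asboolP[W [gW UW0 Wn]] nmax.
exists W; split=> //; apply: primitive_vec_span; first exact: gsub_add.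
move=> v pv; case: (primitive_vec_dichotomy pv (gsub_add gU gW)) => // cap0.
have gv : gsub (gcyclic v) by case: (pv) => e [d [_ _]]; apply: gcyclic_gsub.
have : P (\dim (W + gcyclic v)).
  apply/asboolP; exists (W + gcyclic v)%VS; split=> //; first exact: gsub_add.
  apply/eqP; rewrite -subv0; apply/subvP => u; rewrite memv_cap => /andP[uU].
  move/memv_addP => [w wW [b bv uE]].
  have b0 : b = 0.
    apply/eqP; rewrite -memv0 -cap0 memv_cap bv andbT.
    by rewrite (_ : b = u - w) ?memv_add ?memvN // uE addrC addKr.
  by rewrite -UW0 memv_cap uU uE b0 addr0.
move/nmax; rewrite -Wn => le; have /eqP WE : W == (W + gcyclic v)%VS.
  by rewrite eqEdim addvSl.
by rewrite WE addvA memvE (subv_trans _ (addvSr _ _)) // -memvE gcyclic_self.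
Qed.

(** The projection onto [U] along [W] is a graded homomorphism because both summands are stable
    under the action and the grading. *)
Lemma gsub_proj N (U W : {vspace 'cV[R]_(gmdim N)}) :
  gsub U -> gsub W -> (U :&: W = 0)%VS -> (U + W)%VS = fullv ->
  exists p : 'M_(gmdim N), [/\ @ghom _ _ N N p, p *m p = p &
    forall v, p *m v \in U /\ (v \in U -> p *m v = v)].
Proof.
move=> /gsubP[Ux Ud] /gsubP[Wx Wd] UW0 UWf.
have [p /= pE] := linear_colP (daddv_pi U W); exists p.
have pU v : v \in U -> p *m v = v by move=> vU; rewrite -pE daddv_pi_id.
have pW v : v \in W -> p *m v = 0.
  move=> vW; have WU0 : (W :&: U = 0)%VS by rewrite capvC.
  have vf : v \in (U + W)%VS by rewrite UWf memvf.
  by apply: (addIr v); rewrite -pE add0r -{2}(daddv_pi_id WU0 vW) (daddv_pi_add UW0 vf).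
have dec v : exists u w, [/\ u \in U, w \in W & v = u + w].
  have /memv_addP[u uU [w wW ->]] : v \in (U + W)%VS by rewrite UWf memvf.
  by exists u, w.
split.
- apply/ghomP; split=> [x|d]; apply: mulmx_col_inj => v; have [u [w [uU wW ->]]] := dec v.
    rewrite -!mulmxA !mulmxDr (pU u) // (pW w) // (pU _ (Ux _ _ uU)) (pW _ (Wx _ _ wW)).
    by rewrite mulmx0.
  rewrite -!mulmxA !mulmxDr (pU u) // (pW w) // (pU _ (Ud _ _ uU)) (pW _ (Wd _ _ wW)).
  by rewrite mulmx0.
- apply: mulmx_col_inj => v; have [u [w [uU wW ->]]] := dec v.
  by rewrite -mulmxA !mulmxDr (pU u) // (pW w) // mulmx0 pU.
by move=> v; split=> [|/pU //]; rewrite -pE memv_pi.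
Qed.

End Semisimple.

(** * Decomposition into irreducible modules *)

Section Decomposition.
Variables (R : numFieldType) (B : superAlgType R).
Implicit Types M N : gmod B.

Local Notation gP M := (gpr R (@gmdeg R B M)).

(** Bundling an irreducible module with its inclusion and retraction makes a decomposition a single
    family, convenient for the induction on the dimension. *)
Record summand N := Summand {
  sm_mod : irrmod_ B;
  sm_inj : 'M[R]_(gmdim N, gmdim sm_mod);
  sm_proj : 'M[R]_(gmdim sm_mod, gmdim N);
  sm_inj_ghom : ghom sm_inj;
  sm_proj_ghom : ghom sm_proj;
  sm_injK : sm_proj *m sm_inj = 1%:M
}.

Lemma summand_comp N N' (f : 'M[R]_(gmdim N, gmdim N')) (g : 'M[R]_(gmdim N', gmdim N))
    (fh : ghom f) (gh : ghom g) (gf : g *m f = 1%:M) (s : summand N') :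
  (sm_proj s *m g) *m (f *m sm_inj s) = 1%:M.
Proof. by rewrite mulmxA -(mulmxA (sm_proj s)) gf mulmx1 sm_injK. Qed.

Definition widen_summand N N' (f : 'M[R]_(gmdim N, gmdim N'))
    (g : 'M[R]_(gmdim N', gmdim N)) (fh : ghom f) (gh : ghom g) (gf : g *m f = 1%:M)
    (s : summand N') : summand N :=
  Summand (ghom_comp (sm_inj_ghom s) fh) (ghom_comp gh (sm_proj_ghom s))
    (summand_comp fh gh gf s).

Hypothesis ssB : gsemisimple B.

Lemma exists_primitive_vec N : (0 < gmdim N)%N ->
  exists2 v : 'cV[R]_(gmdim N), primitive_vec v & v != 0.
Proof.
move=> N0; apply: contrapT => none.
have E : 0%VS = fullv :> {vspace 'cV[R]_(gmdim N)}.
  apply: (primitive_vec_span ssB (@gsub0 _ _ N)) => v pv; rewrite memv0.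
  by apply: contrapT => /negP v0; apply: none; exists v.
have : (const_mx 1 : 'cV[R]_(gmdim N)) \in 0%VS by rewrite E memvf.
rewrite memv0 => /eqP/colP/(_ (Ordinal N0))/eqP.
by rewrite !mxE oner_eq0.
Qed.

Lemma ghom_proj_compl N (p : 'M[R]_(gmdim N)) :
  @ghom _ _ N N p -> p *m p = p ->
  @ghom _ _ N N (1%:M - p) /\ (1%:M - p) *m (1%:M - p) = 1%:M - p.
Proof.
move=> /ghomP[px pd] pp; split.
  apply/ghomP; split=> [x|d]; rewrite mulmxBl mulmxBr ?mul1mx ?mulmx1.
    by rewrite px.
  by rewrite pd.
by rewrite mulmxBr mulmx1 mulmxBl mul1mx pp subrr subr0.
Qed.

(** The submodule generated by a nonzero primitive vector is irreducible by the dichotomy; [N'] is a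
    graded complement of it. *)
Lemma irr_summand N : (0 < gmdim N)%N ->
  exists (s : summand N) (N' : gmod B) (f : 'M[R]_(gmdim N, gmdim N'))
    (g : 'M[R]_(gmdim N', gmdim N)),
    [/\ ghom f, ghom g, g *m f = 1%:M & f *m g = 1%:M - sm_inj s *m sm_proj s].
Proof.
move=> N0; have [v pv v0] := exists_primitive_vec N0.
have gv : gsub (gcyclic v) by case: (pv) => e [d [_ _]]; apply: gcyclic_gsub.
have [W [gW UW UWf]] := gsub_compl ssB gv.
have [p [ph pp pU]] := gsub_proj gv gW UW UWf.
have [S [f [g [fh gh gf fg]]]] := ghom_split ph pp.
have [ph' pp'] := ghom_proj_compl ph pp.
have [N' [f' [g' [fh' gh' gf' fg']]]] := ghom_split ph' pp'.
have [/ghomP[fx fd] /ghomP[gx gd]] := (fh, gh).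
have gK w : g *m (f *m w) = w :> 'cV_(gmdim S) by rewrite mulmxA gf mul1mx.
have fU w : f *m w \in gcyclic v.
  by rewrite -(gK w) mulmxA fg; case: (pU (f *m w)).
have irrS : girr S.
  split=> [|X gX].
    rewrite lt0n; apply: contraNneq v0 => S0.
    rewrite -((pU v).2 (gcyclic_self v)) -fg -mulmxA; apply/eqP/matrixP => i j.
    rewrite !mxE big1 // => k _; have := ltn_ord k.
    by rewrite [X in (_ < X)%N]S0 ltn0.
  case: (primitive_vec_dichotomy pv (ghom_gsub_img fh gX)) => [/memv_imgmulmx[x xX vE]|X0].
    right; apply/eqP; rewrite eqEsubv subvf; apply/subvP => w _.
    have /memv_gcyclic[y yE] := fU w.
    rewrite -(gK w) yE vE mulmxA gx -!mulmxA gK.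
    by have [Xx _] := gX; apply: Xx.
  left; apply/eqP; rewrite -subv0; apply/subvP => w wX; rewrite memv0 -(gK w).
  have : f *m w \in ((linfun (mulmx f) @: X) :&: gcyclic v)%VS.
    by rewrite memv_cap fU andbT; apply/memv_imgmulmx; exists w.
  by rewrite X0 memv0 => /eqP ->; rewrite mulmx0.
exists (@Summand N (IrrMod irrS) f g fh gh gf), N', f', g'; split=> //=.
by rewrite fg' fg.
Qed.

Theorem gsemisimple_decomp N : exists (k : nat) (t : 'I_k -> summand N),
  (forall i j, i != j -> sm_proj (t i) *m sm_inj (t j) = 0) /\
  \sum_j sm_inj (t j) *m sm_proj (t j) = 1%:M.
Proof.
have [n] := ubnP (gmdim N); elim: n N => // n IH N leN.
have [N0|N0] := posnP (gmdim N).
  exists 0%N, (fun i : 'I_0 => match notF (ltn_ord i) with end); split=> [[]//|].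
  by apply/matrixP => i; have := ltn_ord i; rewrite [X in (_ < X)%N]N0 ltn0.
have [s [N' [f [g [fh gh gf fg]]]]] := irr_summand N0.
(* Dimensions are compared as traces of complementary idempotents, in characteristic 0. *)
have dimE : (gmdim (sm_mod s) + gmdim N' = gmdim N)%N.
  apply/eqP; rewrite -(eqr_nat R) natrD -[_%:R as X in X + _]mxtrace1 -(mxtrace1 R (gmdim N')).
  rewrite -(sm_injK s) -gf mxtrace_mulC (mxtrace_mulC g) fg linearB /= addrC subrK.
  by rewrite mxtrace1.
have [|k [t [tO tS]]] := IH N'.
  rewrite -ltnS (leq_trans _ leN) // ltnS -dimE -[X in (X < _)%N]add0n ltn_add2r.
  exact: (irr_girr (sm_mod s)).1.
have sg : sm_proj s *m f = 0.
  rewrite -[LHS]mulmx1 -gf mulmxA -(mulmxA _ f) fg mulmxBr mulmx1 mulmxA sm_injK.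
  by rewrite mul1mx subrr mul0mx.
have gs : g *m sm_inj s = 0.
  rewrite -[LHS]mul1mx -gf mulmxA -(mulmxA g) fg mulmxBr mulmx1 mulmxBl -!mulmxA sm_injK.
  by rewrite mulmx1 subrr.
(* Index 0 is the summand split off from [N]; the others come from the complement [N']. *)
pose t' i := if unlift ord0 i is Some j then widen_summand fh gh gf (t j) else s.
exists k.+1, t'; split=> [i j|].
  rewrite /t'; case: unliftP => [i' ->|->]; case: unliftP => [j' ->|->] //=.
  - by rewrite (inj_eq (@lift_inj _ _)) => /tO ij; rewrite mulmxA -(mulmxA (sm_proj _)) gf mulmx1.
  - by rewrite -mulmxA gs mulmx0.
  by rewrite mulmxA sg mul0mx.
have t'0 : t' ord0 = s by rewrite /t' unlift_none.
have t'L j : t' (fintype.lift ord0 j) = widen_summand fh gh gf (t j) by rewrite /t' liftK.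
rewrite big_ord_recl t'0.
rewrite (eq_bigr (fun j => f *m (sm_inj (t j) *m sm_proj (t j)) *m g)) => [|j _].
  by rewrite -mulmx_suml -mulmx_sumr tS mulmx1 fg addrC subrK.
by rewrite t'L /= !mulmxA.
Qed.

Lemma gdsum_irr N : exists (k : nat) (S : 'I_k -> irrmod_ B), gdsum N S.
Proof.
have [k [t [tO tS]]] := gsemisimple_decomp N.
exists k, (fun j => sm_mod (t j)), (fun j => sm_inj (t j)), (fun j => sm_proj (t j)).
by split=> // j; [apply: sm_inj_ghom|apply: sm_proj_ghom|apply: sm_injK].
Qed.

Lemma has_nclsP N : has_ncls N (ncls N).
Proof.
have [k [S d]] := gdsum_irr N; rewrite (@has_ncls_ncls _ _ N (\sum_j << irrcls (S j) >>)).
  by exists k, S.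
by exists k, S.
Qed.

End Decomposition.

(** * Central idempotents and simple blocks *)

Section CentralIdempotents.
Variables (R : numFieldType) (B : superAlgType R).

Definition even_central_idem (z : B) : Prop :=
  [/\ homog false z, forall x, z * x = x * z & z * z = z].

(** If [z e] is nonzero then [y z e = e] for some [y], and multiplying by the central idempotent [z]
    gives [z e = e]. *)
Lemma gprimitive_central e z : gprimitive e -> even_central_idem z ->
  z * e = 0 \/ z * e = e.
Proof.
move=> [_ _ epr] [zh zC zz]; have [ze0|/(epr _ _ zh)[y yE]] := eqVneq (z * e) 0; first by left.
by right; rewrite -yE !mulrA (zC y) -(mulrA y) zz.
Qed.

(** [z] acts by an idempotent graded endomorphism; if nonzero it is invertible by Schur's lemma, and
    an invertible idempotent is the identity. *)
Lemma gmact_central_idem (M : gmod B) z : even_central_idem z -> girr M ->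
  gmact M z = 0 \/ gmact M z = 1%:M.
Proof.
move=> [zh zC zz] irrM; have [|nz] := eqVneq (gmact M z) 0; [by left|right].
have zhom : @ghom _ _ M M (gmact M z).
  by split=> [x|]; [rewrite -!gmactM zC|exact: (gmact_homog zh)].
have [g [_ _ gz]] := girr_schur irrM irrM zhom nz.
have MM : gmact M z *m gmact M z = gmact M z by rewrite -gmactM zz.
by rewrite -[LHS]mul1mx -[X in X *m _]gz -mulmxA MM.
Qed.

End CentralIdempotents.

(** * Matrix algebras over graded division algebras *)

Section GmxSimple.
Variables (R : numFieldType) (D : superAlgType R) (n : nat) (c : 'I_n.+1 -> bool).
Hypothesis divD : gdivision D.
Local Notation C := (gmx D c).

Definition gunit (k l : 'I_n.+1) (x : D) : C :=
  (\matrix_(i, j) (if (i == k) && (j == l) then x else 0) : 'M[D]_n.+1).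

Lemma gunit_mull k l x (y : C) i j :
  (gunit k l x * y : C) i j = if i == k then x * y l j else 0.
Proof.
rewrite mxE (bigD1 l) //= mxE eqxx andbT big1 => [|a ne].
  by rewrite addr0; case: ifP => _; rewrite ?mul0r.
by rewrite mxE (negPf ne) andbF mul0r.
Qed.

Lemma gunit_mulr k l x (y : C) i j :
  (y * gunit k l x : C) i j = if j == l then y i k * x else 0.
Proof.
rewrite mxE (bigD1 k) //= mxE eqxx /= big1 => [|a ne].
  by rewrite addr0; case: ifP => _; rewrite ?mulr0.
by rewrite mxE (negPf ne) mulr0.
Qed.

Lemma gmx_entry_homog d (x : C) i j : homog d x -> homog (c i (+) d (+) c j) (x i j).
Proof. by move=> hx; rewrite /homog -{2}hx mxE. Qed.

Lemma homog_gunit0 : homog false (gunit ord0 ord0 1).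
Proof.
apply/matrixP => i j; rewrite !mxE; case: ifP => [/andP[/eqP -> /eqP ->]|_].
  by rewrite addbF addbb hpart_1.
by rewrite linear0.
Qed.

Lemma gunit_primitive : gprimitive (gunit ord0 ord0 1 : C).
Proof.
split; first exact: homog_gunit0.
  apply/matrixP => i j; rewrite gunit_mull !mxE mul1r eqxx /=.
  by case: (i == ord0).
move=> d x hx xe0; have [k xk0] : exists k, x k ord0 != 0.
  apply: contrapT => none; case/eqP: xe0; apply/matrixP => i j.
  rewrite gunit_mulr mulr1 mxE; case: ifP => // _; apply: contrapT => /eqP xi.
  by apply: none; exists i.
(* The entry [x k ord0] is homogeneous in [D] and nonzero, hence invertible. *)
exists (gunit ord0 k (x k ord0)^-1); apply/matrixP => i j.
rewrite gunit_mulr mulr1 gunit_mull mxE andbC.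
by case: ifP => // _; case: ifP => // _; rewrite mulVr // (divD (gmx_entry_homog k ord0 hx)).
Qed.

Lemma gunit_sum : \sum_k gunit k ord0 1 * gunit ord0 ord0 1 * gunit ord0 k 1 = 1 :> C.
Proof.
apply/matrixP => i j; rewrite summxE mxE (bigD1 j) //= gunit_mulr eqxx mulr1.
rewrite gunit_mulr eqxx mulr1 mxE andbT big1 ?addr0 => [|k ne]; first by case: eqP.
by rewrite gunit_mulr eq_sym (negPf ne).
Qed.

Lemma gmx_semisimple : gsemisimple C.
Proof.
exists 'I_n.+1, (fun k => gunit k ord0 1), (fun _ => gunit ord0 ord0 1), (fun k => gunit ord0 k 1).
split; [move=> _; exact: gunit_primitive|exact: gunit_sum].
Qed.

(** Centrality gives that [z] is the sum of the [e_k0 (z e_00) e_0k], and [z e_00] is either 0 or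
    [e_00]. *)
Lemma gmx_central_idem (z : C) : even_central_idem z -> z = 0 \/ z = 1.
Proof.
move=> zP; have [_ zC _] := zP.
have zE : z = \sum_k gunit k ord0 1 * (z * gunit ord0 ord0 1) * gunit ord0 k 1.
  rewrite -[LHS]mulr1 -gunit_sum mulr_sumr; apply: eq_bigr => k _.
  by rewrite !mulrA zC.
case: (gprimitive_central gunit_primitive zP) => e.
  by left; rewrite zE big1 // => k _; rewrite e mulr0 mul0r.
by right; rewrite zE -gunit_sum; apply: eq_bigr => k _; rewrite e.
Qed.

End GmxSimple.

Section GahomTheory.
Variables (R : fieldType) (A B : superAlgType R) (f : gahom A B).

Lemma gahM x y : f (x * y) = f x * f y. Proof. exact: rmorphM. Qed.
Lemma gah1 : f 1 = 1. Proof. exact: rmorph1. Qed.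
Lemma gah0 : f 0 = 0. Proof. exact: linear0. Qed.
Lemma gahB x y : f (x - y) = f x - f y. Proof. exact: linearB. Qed.
Lemma gah_sum (K : finType) (F : K -> A) : f (\sum_k F k) = \sum_k f (F k).
Proof. exact: linear_sum. Qed.
Lemma gah_homog d x : homog d x -> homog d (f x).
Proof. by move=> hx; rewrite /homog -gah_hpart hx. Qed.

End GahomTheory.

(** * Products of simple blocks *)

Section Wedderburn.
Variables (R : numFieldType) (B : superAlgType R) (I : finType).
Variables (D : I -> superAlgType R) (n : I -> nat) (c : forall i, 'I_(n i).+1 -> bool).
Arguments c : clear implicits.
Variable Phi : forall i, gahom B (gmx (D i) (c i)).
Hypothesis PhiP : wedderburn Phi.

Lemma wedderburn_inj x y : (forall i, Phi i x = Phi i y) -> x = y.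
Proof.
move=> e; have [z [_ zu]] := PhiP.2 (fun i => Phi i y).
by rewrite -(zu x e) (zu y).
Qed.

Lemma wedderburn_inv (y : forall i, gmx (D i) (c i)) : exists x, forall i, Phi i x = y i.
Proof. by have [x [xy _]] := PhiP.2 y; exists x. Qed.

Lemma wedderburn_surj i (y : gmx (D i) (c i)) : exists x, Phi i x = y.
Proof.
have [x xP] := wedderburn_inv (dfwith (fun k => 0 : gmx (D k) (c k)) y).
by exists x; rewrite xP dfwith_in.
Qed.

(** Extension by zero from one block, chosen pointwise; algebraic identities for [u] are checked in
    each component through [wedderburn_inj]. *)
Lemma wedderburn_component i : exists u : gmx (D i) (c i) -> B,
  (forall y, Phi i (u y) = y) /\ forall y k, k != i -> Phi k (u y) = 0.
Proof.
have [u uP] : exists u : gmx (D i) (c i) -> B,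
    forall y k, Phi k (u y) = dfwith (fun k => 0 : gmx (D k) (c k)) y k.
  have [u uP] := boolp.choice (fun y : gmx (D i) (c i) =>
    wedderburn_inv (dfwith (fun k => 0 : gmx (D k) (c k)) y)).
  by exists u.
exists u; split=> [y|y k ne]; first by rewrite uP dfwith_in.
by rewrite uP dfwith_out // eq_sym.
Qed.

Lemma wedderburn_homog d x : (forall i, homog d (Phi i x)) -> homog d x.
Proof. by move=> h; apply: wedderburn_inj => i; rewrite gah_hpart h. Qed.

Lemma wedderburn_idemP i (u : B) : (forall k, Phi k u = (k == i)%:R) -> even_central_idem u.
Proof.
move=> uP; split.
- apply: wedderburn_homog => k; rewrite uP.
  by case: eqP => _; [exact: homog1|exact: linear0].
- move=> x; apply: wedderburn_inj => k; rewrite !gahM uP.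
  by case: eqP; rewrite ?mul1r ?mulr1 ?mul0r ?mulr0.
by apply: wedderburn_inj => k; rewrite !gahM uP -natrM mulnb andbb.
Qed.

Lemma wedderburn_central_idem z : even_central_idem z ->
  forall i, Phi i z = 0 \/ Phi i z = 1.
Proof.
move=> [zh zC zz] i; apply: (gmx_central_idem (PhiP.1 i)); split.
- by rewrite /homog -gah_hpart zh.
- by move=> y; have [x <-] := wedderburn_surj y; rewrite -!gahM zC.
by rewrite -gahM zz.
Qed.

(** The idempotents [e_00] of all blocks, extended by zero, are primitive. [K] indexes the pairs of
    a block and a row, and the sum over one block gives its unit. *)
Lemma wedderburn_semisimple : gsemisimple B.
Proof.
pose K := {i : I & 'I_(n i).+1}.
have [u uP] := all_tag (fun i => cid (wedderburn_component i)).
exists K, (fun k => u _ (gunit (c (tag k)) (tagged k) ord0 1)),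
  (fun k => u _ (gunit (c (tag k)) ord0 ord0 1)),
  (fun k => u _ (gunit (c (tag k)) ord0 (tagged k) 1)); split.
  move=> [i k] /=; have [ui uk] := uP i; have [eh ee epr] := gunit_primitive (c i) (PhiP.1 i).
  split.
  - apply: wedderburn_homog => j; have [<-|ne] := eqVneq i j; first by rewrite ui.
    by rewrite uk 1?eq_sym // /homog linear0.
  - apply: wedderburn_inj => j; rewrite gahM; have [<-|ne] := eqVneq i j; first by rewrite ui.
    by rewrite uk 1?eq_sym // mulr0.
  move=> d x hx xe; have hPx : homog d (Phi i x) by rewrite /homog -gah_hpart hx.
  have [|y yE] := epr _ _ hPx.
    apply: contraNneq xe => xe0; apply/eqP/wedderburn_inj => j; rewrite gahM gah0.
    by have [<-|ne] := eqVneq i j; [rewrite ui|rewrite uk 1?eq_sym // mulr0].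
  exists (u i y); apply: wedderburn_inj => j; rewrite !gahM.
  by have [<-|ne] := eqVneq i j; [rewrite !ui|rewrite !(uk _ j) 1?eq_sym // mulr0].
apply: wedderburn_inj => j; rewrite gah1 gah_sum.
pose F i (k : 'I_(n i).+1) :=
  Phi j (u i (gunit (c i) k ord0 1) * u i (gunit (c i) ord0 ord0 1) * u i (gunit (c i) ord0 k 1)).
transitivity (\sum_i \sum_(k < (n i).+1) F i k); first by rewrite sig_big_dep.
rewrite (bigD1 j) //= [X in _ + X]big1 ?addr0 => [|i ne].
  rewrite -(@gunit_sum _ (D j) _ (c j)); apply: eq_bigr => k _.
  by rewrite /F !gahM !(uP j).1.
by rewrite big1 // => k _; rewrite /F !gahM (uP i).2 1?eq_sym // !mul0r.
Qed.

End Wedderburn.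

(** * Inflation, descent and the decomposition of the cokernel *)

Section PullTheory.
Variables (R : numFieldType) (A B : superAlgType R) (pi : gahom A B).
Implicit Types M N : gmod B.

Lemma gpull_gdsum N (k : nat) (S : 'I_k -> gmod B) :
  gdsum N S -> gdsum (gpull pi N) (fun j => gpull pi (S j)).
Proof.
move=> [f [p [fh ph pf pf0 fp]]]; exists f, p; split=> // j.
  by have [fx fd] := fh j; split=> // x; apply: fx.
by have [px pd] := ph j; split=> // x; apply: px.
Qed.

Lemma gpull_giso M N : giso M N -> giso (gpull pi M) (gpull pi N).
Proof.
move=> [f [g [[fx fd] [gx gd] fg gf]]]; exists f, g; split=> //.
  by split=> // x; apply: fx.
by split=> // x; apply: gx.
Qed.

Hypothesis pi_surj : forall y, exists x, pi x = y.

Lemma gpull_gsub M (U : {vspace 'cV[R]_(gmdim M)}) : @gsub _ _ (gpull pi M) U <-> gsub U.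
Proof.
split=> -[Ux Ud]; split=> // x v vU; last exact: Ux.
by have [y <-] := pi_surj x; apply: (Ux y).
Qed.

Lemma gpull_girr M : girr (gpull pi M) <-> girr M.
Proof.
by split=> -[M0 irrM]; split=> // U gU; apply: irrM; apply/gpull_gsub.
Qed.

Lemma gpull_giso_inj M N : giso (gpull pi M) (gpull pi N) -> giso M N.
Proof.
move=> [f [g [[fx fd] [gx gd] fg gf]]]; exists f, g; split=> //.
  by split=> // x; have [y <-] := pi_surj x; apply: (fx y).
by split=> // x; have [y <-] := pi_surj x; apply: (gx y).
Qed.

Definition irr_pull (S : irrmod_ B) : irrmod_ A := IrrMod ((gpull_girr S).2 (irr_girr S)).

Section Descent.
Variables (N : gmod A) (kerN : forall x, pi x = 0 -> gmact N x = 0).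

Let sec y := sval (cid (pi_surj y)).
Let secK y : pi (sec y) = y := svalP (cid (pi_surj y)).

Lemma gmact_eq_pi x y : pi x = pi y -> gmact N x = gmact N y.
Proof.
by move=> e; apply/eqP; rewrite -subr_eq0 -linearB kerN // gahB e subrr.
Qed.

(** [sec] is an arbitrary set-theoretic section. The result is linear and multiplicative since
    [gmact N x] depends only on [pi x]. *)
Definition gdesc_act y : 'M[R]_(gmdim N) := gmact N (sec y).
Fact gdesc_linear : linear gdesc_act.
Proof.
move=> k x y; transitivity (gmact N (k *: sec x + sec y)); last exact: linearP.
by apply: gmact_eq_pi; rewrite linearP /= !secK.
Qed.
HB.instance Definition _ :=
  GRing.isLinear.Build R B 'M[R]_(gmdim N) _ gdesc_act gdesc_linear.
Fact gdesc_act1 : gdesc_act 1 = 1%:M.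
Proof. by rewrite -(gmact1 N); apply: gmact_eq_pi; rewrite secK gah1. Qed.
Fact gdesc_actM x y : gdesc_act (x * y) = gdesc_act x *m gdesc_act y.
Proof. by rewrite -gmactM; apply: gmact_eq_pi; rewrite gahM !secK. Qed.
Fact gdesc_homog d x : homog d x ->
  forall k j, @gmdeg _ _ N k != d (+) @gmdeg _ _ N j -> gdesc_act x k j = 0.
Proof.
(* A homogeneous element has a homogeneous lift: the degree [d] part of any lift. *)
move=> hx; have -> : gdesc_act x = gmact N (hpart d (sec x)).
  by apply: gmact_eq_pi; rewrite gah_hpart secK hx.
by move=> k j; apply: (gmact_homog (homog_hpart d (sec x))).
Qed.
Definition gdesc : gmod B := GMod gdesc_act1 gdesc_actM gdesc_homog.

Lemma giso_gdesc : giso N (gpull pi gdesc).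
Proof.
have h (f := 1%:M : 'M[R]_(gmdim N)) : @ghom _ _ N (gpull pi gdesc) f.
  split=> [x|k j ne]; last by have [_] := ghom1 N; apply.
  by rewrite mul1mx mulmx1; apply: gmact_eq_pi; rewrite secK.
have h' (f := 1%:M : 'M[R]_(gmdim N)) : @ghom _ _ (gpull pi gdesc) N f.
  by apply: (ghom_inv h); rewrite mul1mx.
by exists 1%:M, 1%:M; split; rewrite ?mul1mx.
Qed.

End Descent.

End PullTheory.

Lemma gpull_comp_giso (R : numFieldType) (A B B' C : superAlgType R) (f : gahom A B)
    (g : gahom B C) (f' : gahom A B') (g' : gahom B' C) (M : gmod C) :
  (forall x, g (f x) = g' (f' x)) -> giso (gpull f (gpull g M)) (gpull f' (gpull g' M)).
Proof.
move=> e.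
have h : @ghom _ _ (gpull f (gpull g M)) (gpull f' (gpull g' M)) (1%:M : 'M[R]_(gmdim M)).
  split=> [x|k j ne]; last by have [_] := ghom1 M; apply.
  by rewrite mul1mx mulmx1 /= /gpull_act /= /gpull_act e.
exists (1%:M : 'M[R]_(gmdim M)), (1%:M : 'M[R]_(gmdim M)).
by split; rewrite ?mul1mx //; apply: (ghom_inv h); rewrite mul1mx.
Qed.

(** * Additive maps on the group of classes and its cokernel *)

Section NgrpTheory.
Variables (R : numFieldType) (B : superAlgType R).

Section Lift.
Variables (M : lmodType int) (F : irrclass B -> M).
Definition Nlift : Ngrp B -> M := fglift F.
Fact Nlift_additive : zmod_morphism Nlift.
Proof. exact: lift_is_additive. Qed.
HB.instance Definition _ := GRing.isZmodMorphism.Build (Ngrp B) M Nlift Nlift_additive.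

Lemma Nlift_cls c : Nlift << c >> = F c.
Proof. by rewrite /Nlift liftU scale1r. Qed.
End Lift.

Lemma Ngrp_ext (M : zmodType) (u v : {additive Ngrp B -> M}) :
  (forall c, u << c >> = v << c >>) -> u =1 v.
Proof.
move=> uv x; rewrite -[x]freeg_sumE !raddf_sum; apply: eq_bigr => c _.
by rewrite -[coeff c x]intz -freegU_mulz !raddfMz uv.
Qed.

Fact restr_additive : zmod_morphism (@restr R B).
Proof. exact: lift_is_additive. Qed.
HB.instance Definition _ :=
  GRing.isZmodMorphism.Build _ (Ngrp B) (@restr R B) restr_additive.

Definition cok (x : Ngrp B) : Acoker B := \pi_(Acoker B) x.
Fact cok_additive : zmod_morphism cok.
Proof. by move=> x y; rewrite /cok piE. Qed.
HB.instance Definition _ := GRing.isZmodMorphism.Build (Ngrp B) (Acoker B) cok cok_additive.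

Lemma cok_eq0 x : cok x = 0 <-> exists y, x = restr y.
Proof.
have -> : (cok x = 0) <-> x \in @restr_im R B.
  rewrite -{1}(raddf0 cok) -[in X in _ <-> X](subr0 x) (Quotient.idealrBE (@restr_im R B)).
  by split=> /eqP.
by split=> /asboolP.
Qed.

Lemma cok_repr (x : Acoker B) : cok (repr x) = x.
Proof. exact: reprK. Qed.

Lemma restr_cls (S : irrmod_ (stens (Cl R 1) B : superAlgType R)) :
  restr << irrcls S >> = ncls (gpull (gsinr (Cl R 1) B) S).
Proof.
rewrite /restr liftU scale1r; apply: ncls_giso; apply: gpull_giso; exact: giso_repr.
Qed.

End NgrpTheory.

Section InflateN.
Variables (R : numFieldType) (A B : superAlgType R) (pi : gahom A B).
Hypothesis pi_surj : forall y, exists x, pi x = y.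

Definition inflN : Ngrp B -> Ngrp A :=
  Nlift (fun c => << irrcls (irr_pull pi_surj (repr c : irrmod_ B)) >> : Ngrp A).
HB.instance Definition _ := GRing.Additive.on inflN.

Lemma inflN_cls (S : irrmod_ B) : inflN << irrcls S >> = << irrcls (irr_pull pi_surj S) >>.
Proof.
by rewrite /inflN Nlift_cls; congr << _ >>; apply/irrcls_eq/gpull_giso/giso_repr.
Qed.

(** Inflation along a surjection keeps irreducibility, so it turns a decomposition of [M] into one
    of the inflated module. *)
Lemma ncls_gpull (M : gmod B) : gsemisimple B -> ncls (gpull pi M) = inflN (ncls M).
Proof.
move=> ssB; have [k [S [d ->]]] := has_nclsP ssB M.
apply: has_ncls_ncls; exists k, (fun j => irr_pull pi_surj (S j)).
split; first exact: (gpull_gdsum pi d).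
by rewrite raddf_sum; apply: eq_bigr => j _ /=; rewrite inflN_cls.
Qed.

End InflateN.

Section StensMap.
Variables (R : numFieldType) (C A B : superAlgType R) (pi : gahom A B).
Local Notation CA := (stens C A).
Local Notation CB := (stens C B).

(** This is [1 (x) pi]: an element of [stens C A] is its family of coordinates along a basis of
    [C]. *)
Definition stens_map (x : CA) : CB := [ffun i => pi (x i)].

Fact stens_map_linear : linear stens_map.
Proof. by move=> k x y; apply/ffunP => i; rewrite !ffunE linearP. Qed.
HB.instance Definition _ := GRing.isLinear.Build R CA CB _ stens_map stens_map_linear.

Lemma stens_map_tens a b : stens_map (tens a b) = tens a (pi b).
Proof. by apply/ffunP => i; rewrite !ffunE linearZ. Qed.

Fact stens_map1 : stens_map 1 = 1.
Proof. by rewrite stens_map_tens gah1. Qed.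

Fact stens_mapM x y : stens_map (x * y) = stens_map x * stens_map y.
Proof.
elim/stens_ind: x => [|x x' Hx Hx'|d d' a b ha hb]; first by rewrite mul0r !linear0 mul0r.
  by rewrite mulrDl !linearD /= Hx Hx' mulrDl.
elim/stens_ind: y => [|y y' Hy Hy'|e e' a' b' ha' hb']; first by rewrite mulr0 !linear0 mulr0.
  by rewrite mulrDr !linearD /= Hy Hy' mulrDr.
rewrite (tensM _ _ hb ha') linearZ /= !stens_map_tens gahM.
by rewrite (tensM _ _ (gah_homog pi hb) ha').
Qed.
HB.instance Definition _ := GRing.isMonoidMorphism.Build CA CB stens_map
  (conj stens_map1 stens_mapM).

Fact stens_map_hpart d x : stens_map (hpart d x) = hpart d (stens_map x).
Proof.
elim/stens_ind: x => [|x x' Hx Hx'|e d' a b ha hb]; first by rewrite !linear0.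
  by rewrite !linearD /= Hx Hx'.
rewrite stens_map_tens (hpart_tens d ha (gah_homog pi hb)) (hpart_tens d ha hb).
by case: ifP; rewrite ?stens_map_tens ?linear0.
Qed.

Definition gstens_map : gahom CA CB := GAHom stens_map_hpart.

Lemma gstens_map_surj : (forall y, exists x, pi x = y) -> forall y, exists x, gstens_map x = y.
Proof.
move=> sur y; exists [ffun i => sval (cid (sur (y i)))].
by apply/ffunP => i; rewrite !ffunE; case: cid.
Qed.

(** Being even, [u] passes odd elements of [C] without a sign, so [1 (x) u] remains central for the
    super product. *)
Lemma tens1_central_idem (u : A) : even_central_idem u -> even_central_idem (tens 1 u : CA).
Proof.
move=> [uh uC uu]; split.
- by rewrite /homog (hpart_tens _ (homog1 _) uh).
- elim/stens_ind=> [|x x' Hx Hx'|d d' a b ha hb]; first by rewrite mulr0 mul0r.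
    by rewrite mulrDr mulrDl Hx Hx'.
  rewrite (tensM _ _ uh ha) (tensM _ _ hb (homog1 _)) /= andbF !scale1r.
  by rewrite mul1r mulr1 uC.
by rewrite (tensM _ _ uh (homog1 _)) scale1r mulr1 uu.
Qed.

End StensMap.

(** * Splitting the cokernel along the blocks *)

Section Blocks.
Variables (R : numFieldType) (A : superAlgType R) (J : finType).
Variable B : J -> superAlgType R.
Variables (pi : forall j, gahom A (B j)) (f : J -> A).
Hypothesis pi_surj : forall j y, exists x, pi j x = y.
Hypothesis pi_inj : forall x, (forall j, pi j x = 0) -> x = 0.
Hypothesis fP : forall j k, pi k (f j) = (k == j)%:R.
Hypothesis f_idem : forall j, even_central_idem (f j).
Hypothesis ssB : forall j, gsemisimple (B j).

Local Notation Cl1 := (Cl R 1).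
Local Notation ClA := (stens Cl1 A : superAlgType R).
Local Notation ClB j := (stens Cl1 (B j) : superAlgType R).

Lemma pi_eq x y : (forall j, pi j x = pi j y) -> x = y.
Proof.
by move=> e; apply/eqP; rewrite -subr_eq0; apply/eqP/pi_inj => j; rewrite gahB e subrr.
Qed.

Lemma block_sum : \sum_j f j = 1.
Proof.
apply: pi_eq => k; rewrite gah_sum gah1 (bigD1 k) //= fP eqxx big1 ?addr0 // => j ne.
by rewrite fP eq_sym (negPf ne).
Qed.

Lemma block_ker j x : pi j x = 0 -> x * f j = 0.
Proof.
move=> x0; apply: pi_inj => k; rewrite gahM fP.
by have [->|_] := eqVneq k j; rewrite ?x0 ?mul0r ?mulr0.
Qed.

(** Each [z j] acts as 0 or 1, and they cannot all act as 0 because their sum is 1. *)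
Lemma irr_central_block (A' : superAlgType R) (z : J -> A') (S : gmod A') :
  (forall j, even_central_idem (z j)) -> \sum_j z j = 1 -> girr S ->
  exists j, gmact S (z j) = 1%:M.
Proof.
move=> zP zsum irrS; apply: contrapT => none; case/eqP: (girr_neq0 irrS).
rewrite -gmact1 -zsum linear_sum big1 // => j _.
by case: (gmact_central_idem (zP j) irrS) => // e; case: none; exists j.
Qed.

(** If [f j] acts as 1, an element [x] of the kernel of [pi j] acts as [x f_j = 0], so [S] descends
    to the block. *)
Lemma irr_block (S : irrmod_ A) : exists j (M : irrmod_ (B j)), giso S (gpull (pi j) M).
Proof.
have [j Sj] := irr_central_block f_idem block_sum (irr_girr S).
have kerS x : pi j x = 0 -> gmact S x = 0.
  by move=> /block_ker xf; rewrite -[LHS]mulmx1 -Sj -gmactM xf linear0.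
have iso := giso_gdesc (@pi_surj j) kerS.
have irrM : girr (gdesc (@pi_surj j) kerS).
  by apply/(gpull_girr (@pi_surj j))/(giso_girr iso)/irr_girr.
by exists j, (IrrMod irrM).
Qed.

Lemma irr_block_Cl (S : irrmod_ ClA) :
  exists j (M : irrmod_ (ClB j)), giso S (gpull (gstens_map Cl1 (pi j)) M).
Proof.
have zP j : even_central_idem (tens 1 (f j) : ClA) by apply: tens1_central_idem.
have zsum : \sum_j tens 1 (f j) = 1 :> ClA.
  by rewrite -tens_sumr block_sum.
have [j Sj] := irr_central_block zP zsum (irr_girr S).
have sur := gstens_map_surj (C := Cl1) (@pi_surj j).
have kerS x : gstens_map Cl1 (pi j) x = 0 -> gmact S x = 0.
  move=> x0; rewrite -[LHS]mulmx1 -Sj -gmactM (_ : x * tens 1 (f j) = 0) ?linear0 //.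
  have [fh _ _] := f_idem j.
  (* All coordinates of [x] lie in the kernel of [pi j]; they are split into homogeneous parts so
     that the sign rule applies. *)
  rewrite [x]tens_coord mulr_suml big1 // => i _; rewrite -[x i]hpart_sum tensDr mulrDl.
  have xih d : hpart d (x i) * f j = 0.
    by apply: block_ker; have /ffunP/(_ i) := x0; rewrite !ffunE gah_hpart => ->; rewrite linear0.
  by rewrite !(tensM _ _ (homog_hpart _ _) (homog1 _)) !andbF !scale1r !mulr1 !xih tens0r addr0.
have iso := giso_gdesc sur kerS.
have irrM : girr (gdesc sur kerS).
  by apply/(gpull_girr sur)/(giso_girr iso)/irr_girr.
by exists j, (IrrMod irrM).
Qed.

(** If the blocks differed, [f j] would act as 1 on one module and as 0 on the other. *)
Lemma block_uniq j k (M : irrmod_ (B j)) (N : irrmod_ (B k)) :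
  giso (gpull (pi j) M) (gpull (pi k) N) -> j = k.
Proof.
move=> [u [v [[ux _] _ uv _]]]; apply/eqP; apply: contraT => ne.
case/eqP: (girr_neq0 (irr_girr N)).
have /= := ux (f j); rewrite /gpull_act !fP eqxx eq_sym (negPf ne) gmact1 mulmx1.
by rewrite linear0 mul0mx => u0; rewrite -uv u0 mul0mx.
Qed.

(** The class of a module of block [j] inflating to [c], or 0 when [c] belongs to another block. The
    choice is harmless because inflation along a surjection reflects isomorphism. *)
Definition block_cls j (c : irrclass A) : Ngrp (B j) :=
  if pselect (exists M : irrmod_ (B j), giso (repr c : irrmod_ A) (gpull (pi j) M)) is left e
  then << irrcls (sval (cid e)) >> else 0.

Definition compN j : Ngrp A -> Ngrp (B j) := Nlift (@block_cls j).
HB.instance Definition _ j := GRing.Additive.on (@compN j).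

Definition infl j : Ngrp (B j) -> Ngrp A := inflN (@pi_surj j).
Arguments infl : clear implicits.
HB.instance Definition _ j := GRing.Additive.on (infl j).

Lemma compN_infl_same j x : compN j (infl j x) = x.
Proof.
pose u : {additive Ngrp (B j) -> Ngrp (B j)} := @compN j \o infl j.
pose v : {additive Ngrp (B j) -> Ngrp (B j)} := idfun.
apply: (@Ngrp_ext _ _ _ u v) => c; rewrite /u /v /=.
rewrite -[c]irrcls_repr /infl inflN_cls /compN Nlift_cls /block_cls.
set S : irrmod_ (B j) := repr c.
case: pselect => [e|[]]; last by exists S; apply: giso_repr.
case: cid => M /= iso; congr << _ >>; apply/irrcls_eq/(gpull_giso_inj (@pi_surj j)).
by apply: giso_trans (giso_sym iso) _; apply: giso_repr.
Qed.

Lemma compN_infl_neq j k x : j != k -> compN j (infl k x) = 0 :> Ngrp (B j).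
Proof.
move=> ne; pose u : {additive Ngrp (B k) -> Ngrp (B j)} := @compN j \o infl k.
pose v : {additive Ngrp (B k) -> Ngrp (B j)} := \0.
apply: (@Ngrp_ext _ _ _ u v) => c; rewrite /u /v /=.
rewrite -[c]irrcls_repr /infl inflN_cls /compN Nlift_cls /block_cls.
case: pselect => // -[M iso]; case/eqP: ne; apply: (@block_uniq _ _ M (repr c)).
by apply: giso_trans (giso_sym iso) _; apply: giso_repr.
Qed.

Lemma infl_compN x : x = \sum_j infl j (compN j x).
Proof.
pose u : {additive Ngrp A -> Ngrp A} := idfun.
have sum_add : zmod_morphism (fun x => \sum_j infl j (compN j x)).
  by move=> y z; rewrite -sumrB; apply: eq_bigr => j _; rewrite !raddfB.
pose v : {additive Ngrp A -> Ngrp A} :=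
  HB.pack (fun x => \sum_j infl j (compN j x)) (GRing.isZmodMorphism.Build _ _ _ sum_add).
apply: (@Ngrp_ext _ _ _ u v) => c; rewrite /u /v /=.
have [j [M iso]] := irr_block (repr c).
have -> : c = irrcls (irr_pull (@pi_surj j) M).
  by rewrite -[LHS]irrcls_repr; apply/irrcls_eq.
rewrite -[<< _ >>](inflN_cls (@pi_surj j)) -/(infl j _).
rewrite (bigD1 j) //= compN_infl_same big1 ?addr0 // => k ne.
by rewrite compN_infl_neq // raddf0.
Qed.

(** Restriction commutes with inflation along [pi j] and [1 (x) pi j], so [infl j] carries
    restricted classes to restricted classes. *)
Lemma infl_restr j (y : Ngrp (ClB j)) : exists z, infl j (restr y) = restr z.
Proof.
have sur := gstens_map_surj (C := Cl1) (@pi_surj j).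
exists (inflN sur y).
pose u : {additive Ngrp (ClB j) -> Ngrp A} := infl j \o @restr R (B j).
pose v : {additive Ngrp (ClB j) -> Ngrp A} := @restr R A \o inflN sur.
apply: (@Ngrp_ext _ _ _ u v) => c; rewrite /u /v /=.
rewrite -[c]irrcls_repr inflN_cls !restr_cls /infl -ncls_gpull //.
by apply: ncls_giso; apply: gpull_comp_giso => x /=; rewrite /sinr stens_map_tens.
Qed.

(** An irreducible module over [Cl1 (x) A] comes from one block, and so does its restriction. It
    suffices to find [z] on generators and extend additively. *)
Lemma compN_restr j (y : Ngrp ClA) : exists z, compN j (restr y) = restr z.
Proof.
suff H c : exists z, compN j (restr << c >>) = restr z.
  have [z zP] := boolp.choice H; exists (Nlift z y).
  pose u : {additive Ngrp ClA -> Ngrp (B j)} := @compN j \o @restr R A.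
  pose v : {additive Ngrp ClA -> Ngrp (B j)} := @restr R (B j) \o Nlift z.
  by apply: (@Ngrp_ext _ _ _ u v) => c; rewrite /u /v /= Nlift_cls.
rewrite -[c]irrcls_repr restr_cls.
have [k [M iso]] := irr_block_Cl (repr c).
have -> : ncls (gpull (gsinr Cl1 A) (repr c : irrmod_ ClA)) = infl k (restr << irrcls M >>).
  rewrite restr_cls /infl -ncls_gpull //; apply: ncls_giso.
  apply: (giso_trans (gpull_giso _ iso)).
  by apply: gpull_comp_giso => x /=; rewrite /sinr stens_map_tens.
have [jk|ne] := eqVneq j k; first by subst k; exists << irrcls M >>; rewrite compN_infl_same.
by exists 0; rewrite compN_infl_neq // raddf0.
Qed.

(** The map induced on the quotients; independence of the representative is [Acomp_cok]. *)
Definition Acomp j (x : Acoker A) : Acoker (B j) := cok (compN j (repr x)).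

Lemma Acomp_cok j (x : Ngrp A) : Acomp j (cok x) = cok (compN j x).
Proof.
apply/eqP; rewrite -subr_eq0 -!raddfB; apply/eqP/cok_eq0.
have /cok_eq0[y ->] : cok (repr (cok x) - x) = 0 by rewrite raddfB /= cok_repr subrr.
exact: compN_restr.
Qed.

Fact Acomp_additive j : zmod_morphism (@Acomp j).
Proof.
move=> x y; rewrite -[x]cok_repr -[y]cok_repr -raddfB /=.
by rewrite !Acomp_cok !raddfB.
Qed.
HB.instance Definition _ j :=
  GRing.isZmodMorphism.Build (Acoker A) (Acoker (B j)) (@Acomp j) (@Acomp_additive j).

Lemma acls_cok (C : superAlgType R) (N : gmod C) : acls N = cok (ncls N).
Proof. by []. Qed.

Theorem Acoker_dsum : is_Acoker_dsum pi (fun j => @Acomp j : {additive _ -> _}).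
Proof.
split=> [j M|j k M ne|y].
- by rewrite !acls_cok /= Acomp_cok (ncls_gpull (@pi_surj j)) // compN_infl_same.
- by rewrite !acls_cok /= Acomp_cok (ncls_gpull (@pi_surj k)) // compN_infl_neq // raddf0.
exists (cok (\sum_j infl j (repr (y j)))); split=> [j|x xP] /=.
  rewrite Acomp_cok raddf_sum (bigD1 j) //= compN_infl_same big1 ?addr0 ?cok_repr // => k ne.
  by rewrite compN_infl_neq // eq_sym.
(* Uniqueness: a lift of [x] is the sum of its inflated components, and each differs from the chosen
   one by a restricted class. *)
rewrite -[x]cok_repr [in RHS](infl_compN (repr x)) !raddf_sum /=; apply: eq_bigr => j _.
apply/eqP; rewrite -subr_eq0 -raddfB -raddfB /=; apply/eqP/cok_eq0.
have /cok_eq0[z ->] : cok (repr (y j) - compN j (repr x)) = 0.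
  by rewrite raddfB /= cok_repr -(xP j) /= subrr.
exact: infl_restr.
Qed.

End Blocks.

(** * The Clifford factor *)

Section CliffordCenter.
Variables (R : numFieldType) (q : nat) (B : superAlgType R).
Local Notation ClB := (stens (Cl R q) B : superAlgType R).
Implicit Types (S : {set 'I_q}) (k : 'I_q).

Definition clmon S : Cl R q := twdelta (cliff_twist R q) S 1.

Lemma clmon_homog S : homog (odd #|S|) (clmon S).
Proof. by rewrite /homog [LHS]twpart_delta /= eqxx. Qed.

Lemma clmon0 : clmon finset.set0 = 1. Proof. by []. Qed.

Lemma cl_expand (a : Cl R q) : a = \sum_S (a S : R) *: clmon S.
Proof.
rewrite [LHS]twE; apply: eq_bigr => S _; apply/ffunP => T; rewrite !ffunE.
by case: eqP => _; rewrite ?scaler0 //; rewrite /GRing.scale /= mulr1.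
Qed.

(** The two sets count the elements of [S] above and below [k]; together these are the elements of
    [S] other than [k]. *)
Lemma inversions_set1 S k :
  odd #|inversions S [set k]| (+) odd #|inversions [set k] S| = odd #|S| (+) (k \in S).
Proof.
have -> : inversions S [set k] = [set (p, k) | p in [set p in S | (k < p)%N]].
  apply/finset.setP => -[x y]; rewrite !inE /=; apply/idP/imsetP.
    by move=> /and3P[xS /eqP -> kx]; exists x; rewrite ?inE ?xS.
  by move=> [p]; rewrite inE => /andP[pS kp] [-> ->]; rewrite pS eqxx.
have -> : inversions [set k] S = [set (k, p) | p in [set p in S | (p < k)%N]].
  apply/finset.setP => -[x y]; rewrite !inE /=; apply/idP/imsetP.
    by move=> /and3P[/eqP -> yS yk]; exists y; rewrite ?inE ?yS.
  by move=> [p]; rewrite inE => /andP[pS kp] [-> ->]; rewrite pS eqxx.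
rewrite !card_imset => [|x y []//|x y []//].
rewrite -oddD -[in RHS](cardsID [set p : 'I_q | (k < p)%N] S).
have -> : S :&: [set p : 'I_q | (k < p)%N] = [set p in S | (k < p)%N].
  by apply/finset.setP => x; rewrite !inE.
rewrite !oddD -addbA; congr (_ (+) _).
rewrite (cardsD1 k (S :\: _)) !inE ltnn /= oddD oddb [RHS]addbC addKb.
congr (odd #|pred_of_set _|); apply/finset.setP => x.
by rewrite !inE -leqNgt -(inj_eq val_inj) /= andbA -ltn_neqAle andbC.
Qed.

Lemma clmon_gen S k :
  clmon S * clgen R k = (-1) ^+ (odd #|S| (+) (k \in S)) *: (clgen R k * clmon S).
Proof.
rewrite /clmon /clgen !twdeltaM /= !mul1r -inversions_set1.
rewrite (_ : setsym S [set k] = setsym [set k] S); last first.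
  by apply/finset.setP => x; rewrite !in_setsym addbC.
rewrite -linearZ /=; congr twdelta; rewrite /GRing.scale /= signr_addb -mulrA.
by rewrite -expr2 sqrr_sign mulr1.
Qed.

Lemma clgen_homog k : homog true (clgen R k).
Proof. by have := clmon_homog [set k]; rewrite cards1. Qed.

(** Moving [b] past the last generator costs [(-1)^|S|], which cancels the [|S|] part of the sign
    from moving [e_S] past [e_k]. *)
Lemma tens_clgen_conj S k (b : B) : homog (odd #|S|) b ->
  tens (clgen R k) 1 * tens (clmon S) b * tens (clgen R k) 1 =
  (-1) ^+ (k \in S) *: tens (clmon S) b :> ClB.
Proof.
move=> hb; rewrite (tensM _ _ (homog1 _) (clmon_homog S)) scale1r mul1r.
rewrite (tensM _ _ hb (clgen_homog k)) andbT mulr1 -mulrA clmon_gen -scalerAr mulrA.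
by rewrite clgen_sqr mul1r tensZl scalerA -signr_addb addKb.
Qed.

Lemma even_cl_expand (z : ClB) : homog false z ->
  exists b : {set 'I_q} -> B, (forall S, homog (odd #|S|) (b S)) /\
    z = \sum_S tens (clmon S) (b S).
Proof.
move=> <-; elim/stens_ind: z => [|x y [b [bh bE]] [b' [bh' bE']]|d d' a b ha hb].
- exists (fun _ => 0); split=> [S|]; first by rewrite /homog linear0.
  by rewrite linear0 big1 // => S _; rewrite tens0r.
- exists (fun S => b S + b' S); split=> [S|]; first by rewrite /homog linearD /= bh bh'.
  by rewrite linearD /= bE bE' -big_split; apply: eq_bigr => S _; rewrite tensDr.
rewrite (hpart_tens _ ha hb); case: eqP => [e|_].
  (* [a] is homogeneous, so its coordinates vanish on every [S] of the wrong parity. *)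
  exists (fun S => (a S : R) *: b); split=> [S|].
    have [o|no] := eqVneq (odd #|S|) d.
      by rewrite /homog linearZ /= o -[in RHS]hb; congr (_ *: hpart _ _); case: d d' e {ha hb o} => [] [].
    have -> : a S = 0.
      by rewrite -ha ffunE /= (negPf no).
    by rewrite scale0r /homog linear0.
  by rewrite {1}(cl_expand a) tens_suml; apply: eq_bigr => S _; rewrite tensZl tensZr.
exists (fun _ => 0); split=> [S|]; first by rewrite /homog linear0.
by rewrite big1 // => S _; rewrite tens0r.
Qed.

(* Conjugation by an odd generator e_k multiplies e_S (x) b, of even total degree,
   by -1 if k is in S and fixes it otherwise. *)
Lemma even_central_cl (z : ClB) : homog false z -> (forall x, z * x = x * z) ->
  exists2 b, homog false b & z = tens 1 b.
Proof.
move=> zh zC; have [b [bh zE]] := even_cl_expand zh.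
(* [l] lists the generators already used; once all of them are, only the empty monomial remains. *)
suff H (l : seq 'I_q) : z = \sum_(S : {set 'I_q} | all (fun k => k \notin S) l) tens (clmon S) (b S).
  exists (b finset.set0); first by have := bh finset.set0; rewrite cards0.
  rewrite (H (enum 'I_q)) (big_pred1 finset.set0) ?clmon0 // => S /=.
  apply/allP/eqP => [Sk|-> k _]; last by rewrite inE.
  by apply/finset.setP => k; rewrite inE; apply/negbTE/Sk; rewrite mem_enum.
elim: l => [|k l IH]; first by rewrite zE; apply: eq_bigl.
have kz : z = tens (clgen R k) 1 * z * tens (clgen R k) 1.
  rewrite -zC -mulrA (tensM _ _ (homog1 _) (clgen_homog k)) scale1r clgen_sqr mul1r.
  by rewrite -[tens 1 1]/(1 : ClB) mulr1.
(* Average [z] with its conjugate by [e_k]: terms with [k] in [S] cancel and the others double. *)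
have z2 : z + z = \sum_(S : {set 'I_q} | all (fun k => k \notin S) (k :: l))
    (tens (clmon S) (b S) + tens (clmon S) (b S)).
  rewrite {2}kz {1 2}IH mulr_sumr mulr_suml -big_split /=.
  rewrite (bigID (fun S : {set 'I_q} => k \in S)) /= big1 ?add0r => [|S /andP[_ kS]].
    apply: eq_big => S; first by rewrite andbC.
    by move=> /andP[_ /negPf kS]; rewrite tens_clgen_conj // kS scale1r.
  by rewrite tens_clgen_conj // kS scaleN1r subrr.
have two : (2%:R : R) != 0 by rewrite pnatr_eq0.
apply: (scalerI two); rewrite scaler_nat mulr2n z2 scaler_sumr.
by apply: eq_bigr => S _; rewrite scaler_nat mulr2n.
Qed.

Lemma tens1_inj : injective (fun b : B => tens 1 b : ClB).
Proof.
move=> b b' /eqP; rewrite -subr_eq0 -(linearB (@sinr _ (Cl R q) B)) => /eqP e.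
by apply/eqP; rewrite -subr_eq0 (tens_eq0 (oner_neq0 _) e).
Qed.

Lemma even_central_idem_cl (z : ClB) : even_central_idem z ->
  exists2 b : B, even_central_idem b & z = tens 1 b.
Proof.
move=> [zh zC zz]; have [b bh zE] := even_central_cl zh zC; exists b => //.
have sM x y : tens 1 x * tens 1 y = tens 1 (x * y) :> ClB by exact: (esym (sinrM (Cl R q) x y)).
split=> //; first by move=> x; apply: tens1_inj; rewrite -!sM -zE zC.
by apply: tens1_inj; rewrite -sM -zE.
Qed.

End CliffordCenter.

(** * Matching the blocks of the two decompositions *)

Section Separation.
Variables (R : numFieldType) (q : nat) (A B : superAlgType R).
Variables (Psi : gahom A (stens (Cl R q) B)) (Psi_bij : bijective Psi).
Variables (I : finType) (D : I -> superAlgType R) (d' : I -> nat).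
Variables (c : forall i, 'I_(d' i).+1 -> bool).
Arguments c : clear implicits.
Variables (Phi : forall i, gahom B (gmx (D i) (c i))) (PhiP : wedderburn Phi).
Variables (u : I -> B) (uP : forall i k, Phi k (u i) = (k == i)%:R).
Variables (a : I -> A) (aP : forall i, Psi (a i) = tens 1 (u i)).
Variables (J : finType) (E : J -> superAlgType R) (d : J -> nat).
Variables (b : forall j, 'I_(d j).+1 -> bool).
Arguments b : clear implicits.
Variables (PhiV : forall j, gahom A (gmx (E j) (b j))) (PhiVP : wedderburn PhiV).

Let Psi_inj : injective Psi := bij_inj Psi_bij.

Lemma sum_blocks : \sum_i a i = 1.
Proof.
apply: Psi_inj; rewrite gah_sum gah1 (eq_bigr _ (fun i _ => aP i)) -tens_sumr.
congr tens; apply: (wedderburn_inj PhiP) => k; rewrite gah_sum gah1 (bigD1 k) //=.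
by rewrite uP eqxx big1 ?addr0 // => i ne; rewrite uP eq_sym (negPf ne).
Qed.

Lemma u_idem i : even_central_idem (u i).
Proof. exact: (wedderburn_idemP PhiP (i := i)). Qed.

Lemma a_idem i : even_central_idem (a i).
Proof.
have [h C e] := tens1_central_idem (Cl R q) (u_idem i); split.
- by apply: Psi_inj; rewrite gah_hpart aP h.
- by move=> x; apply: Psi_inj; rewrite !gahM aP C.
by apply: Psi_inj; rewrite gahM aP e.
Qed.

Lemma blocks_orth i k : i != k -> a i * a k = 0.
Proof.
move=> /negPf ne; apply: Psi_inj; have [uh _ _] := u_idem i.
rewrite gahM gah0 !aP (tensM _ _ uh (homog1 _)) scale1r mulr1.
rewrite (_ : u i * u k = 0) ?tens0r //; apply: (wedderburn_inj PhiP) => l.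
by rewrite gahM gah0 !uP; have [->|_] := eqVneq l i; rewrite ?ne ?mulr0 ?mul0r.
Qed.

(** The [a i] are orthogonal with sum 1 and map to 0 or 1 in each simple block of [A], so block [j]
    lies under exactly one [a (tau j)]. The map [tau] is onto since [a i] is nonzero, and one-to-one
    since each block idempotent of [A] equals [a (tau j)]; [sigma] is its inverse. *)
Lemma separation_bij : exists sigma : I -> J,
  bijective sigma /\ forall i j, PhiV j (a i) = (j == sigma i)%:R.
Proof.
have tauP j : exists i, PhiV j (a i) = 1.
  apply: contrapT => none; have := oner_neq0 (gmx (E j) (b j)); case/eqP.
  rewrite -(gah1 (PhiV j)) -sum_blocks gah_sum big1 // => i _.
  by case: (wedderburn_central_idem PhiVP (a_idem i) j) => // e; case: none; exists i.
have {tauP} [tau tauP] := boolp.choice tauP.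
have tauE j i : PhiV j (a i) = (i == tau j)%:R.
  have [->|ne] := eqVneq i (tau j); first by rewrite tauP.
  by rewrite -[LHS]mulr1 -(tauP j) -gahM blocks_orth // gah0.
have tau_surj i : exists j, tau j = i.
  apply: contrapT => none.
  have a0 : a i = 0.
    apply: (wedderburn_inj PhiVP) => j; rewrite tauE gah0.
    by case: eqP => // e; case: none; exists j.
  have : u i = 0 by apply: (tens_eq0 (oner_neq0 (Cl R q))); rewrite -aP a0 gah0.
  by move/(congr1 (Phi i)); rewrite uP eqxx gah0 => /eqP; rewrite oner_eq0.
have [f fP] := boolp.choice (fun j => wedderburn_inv PhiVP (fun k => (k == j)%:R)).
(* The idempotent [f j] is [1 (x) x] with [x] an even central idempotent below [u (tau j)];
   simplicity of that block of [B] and [f j] being nonzero force [x = u (tau j)]. *)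
have fE j : f j = a (tau j).
  have f_idem : even_central_idem (f j) by apply: (wedderburn_idemP PhiVP (i := j)).
  have Psif : even_central_idem (Psi (f j)).
    have [h C e] := f_idem; split; first exact: gah_homog.
      by have [Psi' _ PsiK] := Psi_bij; move=> x; rewrite -[x]PsiK -!gahM C.
    by rewrite -gahM e.
  have [x xP fx] := even_central_idem_cl Psif.
  have fa : f j * a (tau j) = f j.
    apply: (wedderburn_inj PhiVP) => k; rewrite gahM fP tauE.
    by have [->|_] := eqVneq k j; rewrite ?eqxx ?mulr1 ?mul0r.
  have xu : x * u (tau j) = x.
    have [xh _ _] := xP; apply: (@tens1_inj R q B) => /=.
    have := congr1 Psi fa; rewrite gahM fx aP (tensM _ _ xh (homog1 _)) scale1r.
    by rewrite mulr1.
  have xk k : k != tau j -> Phi k x = 0.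
    by move=> /negPf ne; rewrite -xu gahM uP ne mulr0.
  have xE : x = u (tau j).
    apply: (wedderburn_inj PhiP) => k; rewrite uP.
    have [->|ne] := eqVneq k (tau j); last exact: xk.
    case: (wedderburn_central_idem PhiP xP (tau j)) => // x0.
    have x00 : x = 0.
      apply: (wedderburn_inj PhiP) => l; rewrite gah0.
      by have [->|/xk] := eqVneq l (tau j).
    have f0 : f j = 0 by apply: Psi_inj; rewrite fx x00 tens0r gah0.
    have := fP j j; rewrite f0 gah0 eqxx => /esym/eqP.
    by rewrite oner_eq0.
  by apply: Psi_inj; rewrite aP fx xE.
have tau_inj : injective tau.
  move=> j1 j2 e; have := fP j1 j2; rewrite fE e tauP.
  by have [//|_ /eqP] := eqVneq j2 j1; rewrite oner_eq0.
have [sigma sigmaP] := boolp.choice tau_surj.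
have sigmaK j : sigma (tau j) = j by apply: tau_inj; rewrite sigmaP.
exists sigma; split; first by exists tau.
by move=> i j; rewrite tauE -{1}(sigmaP i) (inj_eq tau_inj) eq_sym.
Qed.

End Separation.

(** * Summands of order two *)

Section PrimitiveVectors.
Variables (R : numFieldType) (B : superAlgType R).
Local Notation gP M := (gpr R (@gmdeg R B M)).

(** As [v] is homogeneous, each homogeneous part of [x] kills it. If such a part had a nonzero
    product with [e], primitivity would recover [v] from 0; hence the product is 0 and the part
    kills [w = e w]. *)
Lemma primitive_vec_kill (M N : gmod B) (e : B) (d : bool)
    (v : 'cV[R]_(gmdim M)) (w : 'cV[R]_(gmdim N)) :
  gprimitive e -> v != 0 -> gmact M e *m v = v -> gP M d *m v = v -> gmact N e *m w = w ->
  forall x, gmact M x *m v = 0 -> gmact N x *m w = 0.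
Proof.
move=> [eh ee epr] v0 ev dv ew x xv.
have hx g : gmact N (hpart g x) *m w = 0.
  have xgv : gmact M (hpart g x) *m v = 0.
    have := gmact_hpart M d (g (+) d) x; rewrite addbK => /(congr1 (fun X => X *m v)).
    by rewrite -!mulmxA dv xv mulmx0.
  have [xe|xe] := eqVneq (hpart g x * e) 0.
    by rewrite -ew mulmxA -gmactM xe linear0 mul0mx.
  have [y yE] := epr _ _ (homog_hpart g x) xe.
  case/eqP: v0; rewrite -ev -yE -mulrA !gmactM -!mulmxA ev xgv.
  by rewrite mulmx0.
by rewrite -[x]hpart_sum linearD mulmxDl /= !hx addr0.
Qed.

(* x v |-> x w is well defined since both vectors have the same annihilator. *)
Lemma giso_primitive_vec (M N : gmod B) (e : B) (d : bool)
    (v : 'cV[R]_(gmdim M)) (w : 'cV[R]_(gmdim N)) :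
  girr M -> girr N -> gprimitive e ->
  v != 0 -> gmact M e *m v = v -> gP M d *m v = v ->
  w != 0 -> gmact N e *m w = w -> gP N d *m w = w -> giso M N.
Proof.
move=> irrM irrN pe v0 ev dv w0 ew dw.
have kill := primitive_vec_kill pe v0 ev dv ew.
have cyc : gcyclic v = fullv.
  case: (irrM.2 _ (gcyclic_gsub dv)) => // c0; case/eqP: v0; apply/eqP.
  by rewrite -memv0 -c0 gcyclic_self.
have sP (z : 'cV_(gmdim M)) : exists x, z = gmact M x *m v.
  by apply/memv_gcyclic; rewrite cyc memvf.
have {sP} [s sP] := boolp.choice sP.
have sE x y : gmact M x *m v = gmact M y *m v -> gmact N x *m w = gmact N y *m w.
  move=> e1; apply/eqP; rewrite -subr_eq0 -mulmxBl -linearB; apply/eqP/kill.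
  by rewrite linearB mulmxBl /= e1 subrr.
pose g z := gmact N (s z) *m w.
have gE x : g (gmact M x *m v) = gmact N x *m w by apply: sE; rewrite -sP.
have g_lin : linear g.
  move=> k x y; rewrite /g; transitivity (gmact N (k *: s x + s y) *m w).
    by apply: sE; rewrite linearP mulmxDl -scalemxAl -!sP.
  by rewrite linearP mulmxDl -scalemxAl.
have [G GE] := linear_colP (HB.pack g (GRing.isLinear.Build _ _ _ _ g g_lin)
  : {linear 'cV[R]_(gmdim M) -> 'cV[R]_(gmdim N)}).
have {}GE x : G *m (gmact M x *m v) = gmact N x *m w by rewrite -gE; have /= <- := GE (gmact M x *m v).
have Gh : ghom G.
  apply/ghomP; split=> [x|f]; apply: mulmx_col_inj => z; rewrite (sP z) -!mulmxA GE.
    by rewrite (mulmxA (gmact M x)) -gmactM GE gmactM -mulmxA.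
  (* [v] and [w] have the same degree [d], which makes [G] preserve degrees. *)
  have hM := congr1 (fun X => X *m v) (gmact_hpart M d f (s z)).
  have hN := congr1 (fun X => X *m w) (gmact_hpart N d f (s z)).
  by move: hM hN; rewrite /= -!mulmxA dv dw => -> ->; rewrite GE.
have G0 : G != 0.
  apply: contraNneq w0 => G0; have := GE 1.
  by rewrite !gmact1 !mul1mx G0 mul0mx => <-.
have [G' [h' e1 e2]] := girr_schur irrM irrN Gh G0.
by exists G, G'.
Qed.

End PrimitiveVectors.

Section OrderTwo.
Variables (R : numFieldType) (D : superAlgType R) (n : nat) (c : 'I_n.+1 -> bool).
Hypothesis divD : gdivision D.
Local Notation C := (gmx D c : superAlgType R).
Local Notation ClC := (stens (Cl R 1) C : superAlgType R).
Local Notation gP B M := (gpr R (@gmdeg R B M)).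
Local Notation eps := (gunit c ord0 ord0 1 : C).

(** The action of [x] composed with the parity operator; its trace is the supertrace of [x]. *)
Definition even_minus_odd (B : superAlgType R) (x : B) (M : gmod B) : 'M[R]_(gmdim M) :=
  gmact M x *m (gP B M false - gP B M true).

Lemma even_minus_odd_ghom (B : superAlgType R) (x : B) M N (f : 'M[R]_(gmdim N, gmdim M)) :
  ghom f -> f *m even_minus_odd x M = even_minus_odd x N *m f.
Proof.
move=> /ghomP[fx fd].
by rewrite /even_minus_odd mulmxA fx -!mulmxA mulmxBr mulmxBl !fd.
Qed.

(** The target is [R] seen as a module over the integers, as required for the extension from the
    free abelian group. *)
Definition supertrace : Ngrp C -> zmodule R :=
  Nlift (fun k => \tr (even_minus_odd eps (repr k : irrmod_ C)) : zmodule R).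
HB.instance Definition _ := GRing.Additive.on supertrace.

Lemma supertrace_cls (S : irrmod_ C) :
  supertrace << irrcls S >> = \tr (even_minus_odd eps S).
Proof.
rewrite /supertrace Nlift_cls; apply: giso_tr; last exact: giso_repr.
exact: even_minus_odd_ghom.
Qed.

Lemma supertrace_ncls (M : gmod C) : supertrace (ncls M) = \tr (even_minus_odd eps M).
Proof.
have [k [S [d ->]]] := has_nclsP (gmx_semisimple c divD) M.
rewrite (gdsum_tr (@even_minus_odd_ghom C eps) d) raddf_sum; apply: eq_bigr => j _ /=.
exact: supertrace_cls.
Qed.

(* The odd involution of Cl^{0,1} exchanges the even and the odd part of e_00 M. *)
Lemma supertrace_restr y : supertrace (restr y) = 0.
Proof.
pose s : {additive Ngrp ClC -> zmodule R} := supertrace \o @restr R C.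
pose z : {additive Ngrp ClC -> zmodule R} := \0.
apply: (@Ngrp_ext _ _ _ s z) => k; rewrite /s /z /= -[k]irrcls_repr restr_cls supertrace_ncls.
set M : irrmod_ ClC := repr k; set G := gpull _ _.
have := clgen_homog R (ord0 : 'I_1) => gh.
pose X : ClC := tens (clgen R ord0) 1.
have Xh : homog true X by rewrite /homog (hpart_tens _ gh (homog1 _)).
have XX : X * X = 1 by rewrite (tensM _ _ (homog1 _) gh) scale1r clgen_sqr mulr1.
have eh := @homog_gunit0 _ D _ c.
(* No sign arises, because [eps] is even. *)
have Xe : X * tens 1 eps = tens 1 eps * X.
  by rewrite (tensM _ _ (homog1 _) (homog1 _)) (tensM _ _ eh gh) !scale1r !mul1r !mulr1.
pose O := gmact M X.
have OO : O *m O = 1%:M by rewrite -gmactM XX gmact1.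
have OP d : O *m gP C G d = gP C G (~~ d) *m O by have := gmact_gpr M d Xh.
have Oe : O *m gmact G eps = gmact G eps *m O.
  by rewrite /= /gpull_act /= /sinr -!gmactM Xe.
set T := even_minus_odd eps G.
have OT : O *m T *m O = - T.
  rewrite /T /even_minus_odd mulmxA Oe -!mulmxA (mulmxA O) mulmxBr !OP /= -mulmxBl -mulmxA OO.
  by rewrite mulmx1 -opprB mulmxN.
(* Conjugation by the involution [O] preserves the trace but changes the sign of [T]. *)
have T2 : \tr T = - \tr T.
  by rewrite -[in LHS](mulmx1 T) -OO mulmxA mxtrace_mulC mulmxA OT linearN.
apply/eqP; have : \tr T + \tr T == 0 by rewrite {1}T2 addNr.
by rewrite -mulr2n mulrn_eq0.
Qed.

Variable phi : {additive Acoker C -> 'Z_2}.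
Hypothesis phi_bij : bijective phi.

(** Twice the class of [S] vanishes in the cokernel, so it is a restricted class and has supertrace
    0; divide by 2. *)
Lemma supertrace_Z2 (S : irrmod_ C) : \tr (even_minus_odd eps S) = 0.
Proof.
have c2 : cok (<< irrcls S >> + << irrcls S >>) = 0.
  apply: (bij_inj phi_bij); rewrite !raddfD raddf0 /=.
  by case: (phi _) => -[|[|//]] //= i; apply: val_inj.
have [y yE] := (cok_eq0 _).1 c2.
have := supertrace_restr y; rewrite -yE raddfD /= supertrace_cls => /eqP.
by rewrite -mulr2n mulrn_eq0 => /eqP.
Qed.

(** If the even part of [e_00 S] were zero, the odd part would have trace 0 as well. The trace of an
    idempotent is its rank, so [e_00], and with it the unit, would act as 0. *)
Lemma even_primitive_vec (S : irrmod_ C) : exists v : 'cV[R]_(gmdim S),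
  [/\ v != 0, gmact S eps *m v = v & gP C S false *m v = v].
Proof.
have [eh ee _] := gunit_primitive c divD.
have EP d : gmact S eps *m gP C S d = gP C S d *m gmact S eps by have := gmact_gpr S d eh.
have EE : gmact S eps *m gmact S eps = gmact S eps by rewrite -gmactM ee.
have idem d : (gmact S eps *m gP C S d) *m (gmact S eps *m gP C S d) = gmact S eps *m gP C S d.
  by rewrite {1}EP -mulmxA (mulmxA _ _ (gP C S d)) EE mulmxA -EP -mulmxA gprM eqxx.
have E0 : gmact S eps *m gP C S false != 0.
  apply/eqP => E0; have := supertrace_Z2 S; rewrite /even_minus_odd mulmxBr E0 sub0r linearN /=.
  have [r [F [Q [FQ QF]]]] := mx_idem_split (idem true).
  move/eqP; rewrite oppr_eq0 -FQ mxtrace_mulC QF mxtrace1 pnatr_eq0 => /eqP r0.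
  have E1 : gmact S eps *m gP C S true = 0.
    rewrite -FQ; apply/matrixP => i j; rewrite !mxE big1 // => k _; have := ltn_ord k.
    by rewrite [X in (_ < X)%N]r0 ltn0.
  have E : gmact S eps = 0.
    by rewrite -[LHS]mulmx1 -(gpr_sum R (@gmdeg _ _ S)) mulmxDr E0 E1 addr0.
  case/eqP: (girr_neq0 (irr_girr S)); rewrite -gmact1 -(@gunit_sum _ D _ c) linear_sum big1 // => k _ /=.
  by rewrite !gmactM E mulmx0 mul0mx.
have [w w0] : exists w : 'cV[R]_(gmdim S), gmact S eps *m gP C S false *m w != 0.
  apply: contrapT => none; case/eqP: E0; apply: mulmx_col_inj => w; rewrite mul0mx.
  by apply: contrapT => /eqP ?; apply: none; exists w.
exists (gmact S eps *m gP C S false *m w); split=> //; first by rewrite !mulmxA EE.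
by rewrite EP !mulmxA gprM.
Qed.

Lemma giso_Z2 (S S' : irrmod_ C) : giso S S'.
Proof.
have [v [v0 ev dv]] := even_primitive_vec S.
have [w [w0 ew dw]] := even_primitive_vec S'.
exact: (giso_primitive_vec (irr_girr S) (irr_girr S') (gunit_primitive c divD) v0 ev dv w0 ew dw).
Qed.

(** All irreducible modules are isomorphic, so if one class went to 0 then [phi] would vanish,
    contradicting surjectivity. *)
Lemma phi_Z2 (S : irrmod_ C) : phi (cok << irrcls S >>) = 1.
Proof.
have [e|ne] := eqVneq (phi (cok << irrcls S >>)) 0; last first.
  by move: ne; case: (phi _) => -[|[|//]] //= i ne; apply: val_inj.
pose s : {additive Ngrp C -> 'Z_2} := phi \o @cok R C.
pose z : {additive Ngrp C -> 'Z_2} := \0.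
have sz : s =1 z.
  apply: Ngrp_ext => k; rewrite /s /z /= -[k]irrcls_repr.
  by have -> : irrcls (repr k : irrmod_ C) = irrcls S by apply/irrcls_eq/giso_Z2.
have [psi _ psiK] := phi_bij.
by have := sz (repr (psi 1)); rewrite /s /z /= cok_repr psiK.
Qed.

End OrderTwo.

(** * The trace formula *)

Theorem mainTheorem6 (R : realType) (gT : finGroupType) (s h : zhom gT)
    (w : cocycle R s) (q : nat) (V : orthrep R gT q) (L : pinlift V)
    (AV : superAlgType R) (iota : gahom (tga w h) AV) (e : 'I_q -> AV)
    (AVP : is_AV V iota e)
    (Psi : gahom AV (stens (Cl R q) (tga (omega' h w L) (ho V h))))
    (Psi_bij : bijective Psi)
    (Psi_e : forall i, Psi (e i) = tens (clgen R i) 1)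
    (Psi_g : forall g, Psi (iota (tga_g w h g)) = tens (L g) (tga_g _ _ g))
    (Psi_z : forall z, Psi (iota (tga_z w h z)) = tens 1 (tga_z _ _ z))
    (I : finType) (D : I -> superAlgType R) (d' : I -> nat)
    (c : forall i, 'I_(d' i).+1 -> bool)
    (Phi : forall i, gahom (tga (omega' h w L) (ho V h)) (gmx (D i) (c i)))
    (PhiP : wedderburn Phi)
    (* u i = Phi^-1 (1_i) and a i = Psi^-1 (1 (x) u i) *)
    (u : I -> tga (omega' h w L) (ho V h))
    (uP : forall i k, Phi k (u i) = (k == i)%:R)
    (a : I -> AV) (aP : forall i, Psi (a i) = tens 1 (u i))
    (J : finType) (E : J -> superAlgType R) (d : J -> nat)
    (b : forall j, 'I_(d j).+1 -> bool)
    (PhiV : forall j, gahom AV (gmx (E j) (b j)))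
    (PhiVP : wedderburn PhiV) :
  exists sigma : I -> J,
    [/\ bijective sigma,
        forall i j, PhiV j (a i) = (j == sigma i)%:R &
        exists2 comp : forall j, {additive Acoker AV -> Acoker (gmx (E j) (b j))},
          is_Acoker_dsum PhiV comp &
          forall (i : I) (phi : {additive Acoker (gmx (E (sigma i)) (b (sigma i))) -> 'Z_2}),
            bijective phi ->
          forall S : gmod AV, girr S -> belongs (PhiV (sigma i)) S ->
          forall N : gmod AV, exists m : nat,
            \tr (gmact N (a i)) / (gmdim S)%:R = m%:R /\
            phi (comp (sigma i) (acls N)) = m%:R].
Proof.
have [sigma [sigma_bij aE]] := separation_bij Psi_bij PhiP uP aP PhiVP.
have [f fP] := boolp.choice (fun j => wedderburn_inv PhiVP (fun k => (k == j)%:R)).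
have f_idem j : even_central_idem (f j) by apply: (wedderburn_idemP PhiVP (i := j)).
have surV j := wedderburn_surj PhiVP (i := j).
have injV x : (forall j, PhiV j x = 0) -> x = 0.
  by move=> x0; apply: (wedderburn_inj PhiVP) => j; rewrite x0 gah0.
have ssA := wedderburn_semisimple PhiVP.
have ssE j := gmx_semisimple (b j) (PhiVP.1 j).
exists sigma; split=> //.
have dsum := Acoker_dsum surV injV fP f_idem ssE.
eexists; first exact: dsum.
move=> i phi phi_bij S irrS [M0 isoS] N.
have irrM0 : girr M0 by apply/(gpull_girr (surV (sigma i)))/(giso_girr isoS).
(* All irreducible modules of the block are isomorphic to [M0], which inflates to [S]; so they share
   the dimension of [S]. *)
have dimE (M : irrmod_ (gmx (E (sigma i)) (b (sigma i)))) : (gmdim M)%:R = (gmdim S)%:R :> R.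
  have := giso_Z2 (PhiVP.1 (sigma i)) phi_bij M (IrrMod irrM0).
  move/(gpull_giso (PhiV (sigma i)))/giso_trans/(_ (giso_sym isoS)).
  move/(giso_tr (F := fun P => 1%:M)); rewrite !mxtrace1; apply=> P Q g _.
  by rewrite mulmx1 mul1mx.
have S0 : (gmdim S)%:R != 0 :> R by rewrite pnatr_eq0 -lt0n; case: irrS.
have tr_nat := fun P Q (g : 'M[R]_(gmdim Q, gmdim P)) (gh : ghom g) => gh.1 (a i).
(* An irreducible summand contributes 1 to both sides if it belongs to block [sigma i] and 0
   otherwise. *)
have contrib (T : irrmod_ AV) : exists t : bool,
    \tr (gmact T (a i)) = t%:R * (gmdim S)%:R /\
    phi (Acomp PhiV (sigma i) (cok << irrcls T >>)) = t%:R.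
  have [j [M iso]] := irr_block surV injV fP f_idem T.
  have TE : << irrcls T >> = infl surV << irrcls M >> :> Ngrp AV.
    by rewrite /infl inflN_cls; congr << _ >>; apply/irrcls_eq.
  exists (j == sigma i); rewrite (giso_tr tr_nat iso) /= /gpull_act aE TE.
  rewrite (Acomp_cok surV injV fP f_idem ssE).
  have [ej|ne] := eqVneq j (sigma i).
    subst j; rewrite gmact1 mxtrace1 mul1r (compN_infl_same surV).
    by rewrite dimE (phi_Z2 (PhiVP.1 (sigma i)) phi_bij).
  rewrite linear0 mxtrace0 mul0r (compN_infl_neq surV fP) 1?eq_sym //.
  by rewrite !raddf0.
have [k [T [d0 NE]]] := has_nclsP ssA N.
have [t tP] := boolp.choice (fun j => contrib (T j)).
(* The number of irreducible summands of [N] in the block. *)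
exists (\sum_j t j)%N; split.
  rewrite (gdsum_tr tr_nat d0) natr_sum mulr_suml; apply: eq_bigr => j _.
  by rewrite (tP j).1 mulfK.
rewrite natr_sum acls_cok NE !raddf_sum; apply: eq_bigr => j _ /=.
exact: (tP j).2.
Qed.
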